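(* The Schur complement $S=\mu D+B^\circ A^{-1}(B^\circ)^T$ of the regularized matrix $$\mathcal{A}=\begin{bmatrix}A&-(B^\circ)^T\\-B^\circ&-\mu D\end{bmatrix}$$ is symmetric and positive definite. Moreover, there holds $$\mu D\le S\le\left(d+\mu\frac{d_{11}}{|K_1|}\right)M_p^\circ,$$ where $|K_1|$ is the volume of the first element and the inequalities are in the sense of symmetric positive semi-definite ordering.
   Context: Setting. $\Omega\subset\mathbb{R}^d$ ($d=2$ or $3$) is a bounded polygonal/polyhedral domain, $\mu>0$ (viscosity), $\mathcal{T}_h=\{K_1,\dots,K_N\}$ is a quasi-uniform simplicial mesh of $\Omega$ that is connected (any two elements are joined by a chain of elements in which consecutive ones share an interior facet). $|K|$, $|e|$ denote measures. The facets of $K$ are $e_{K,i}$, $i=1,\dots,d+1$, with unit outward normals $\mathbf{n}_{K,i}$. Discrete spaces. $\mathbf{V}_h^0$: all $\mathbf{u}=\{\mathbf{u}^\circ,\mathbf{u}^\partial\}$ with a constant vector $\mathbf{u}_K^\circ\in\mathbb{R}^d$ on the interior of each element $K$ and a (single-valued) constant vector $\mathbf{u}^\partial_e\in\mathbb{R}^d$ on each facet $e$, with $\mathbf{u}^\partial_e=0$ for $e\subset\partial\Omega$; write $\mathbf{u}^\partial_{K,i}$ for the value on $e_{K,i}$. $W_h$: functions constant on each element. Elements of $\mathbf{V}_h^0$ and $W_h$ are identified with the vectors of their values (boundary facets excluded), e.g. $\mathbf{q}=(q_{K_1},\dots,q_{K_N})^T$. Weak gradient. With $RT_0(K)=P_0(K)^d+\mathbf{x}P_0(K)$,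 for a scalar $u=(u^\circ,u^\partial)$, $\nabla_w u|_K\in RT_0(K)$ is defined by $(\nabla_w u,\mathbf{w})_K=(u^\partial,\mathbf{w}\cdot\mathbf{n})_{\partial K}-(u^\circ,\nabla\cdot\mathbf{w})_K$ for all $\mathbf{w}\in RT_0(K)$ ($L^2$ inner products); for vector-valued $\mathbf{u}$ it is applied componentwise, giving the rows of a matrix. Matrices. $A$ (symmetric positive definite) is defined by $\mathbf{v}^TA\mathbf{u}=\sum_{K}(\nabla_w\mathbf{u},\nabla_w\mathbf{v})_K$ for $\mathbf{u},\mathbf{v}\in\mathbf{V}_h^0$. $B^\circ$ is defined by $\mathbf{q}^TB^\circ\mathbf{u}=\sum_{K}\sum_{i:\,e_{K,i}\not\subset\partial\Omega}|e_{K,i}|\,q_K(\mathbf{u}^\partial_{K,i})^T\mathbf{n}_{K,i}$. $M_p^\circ=\mathrm{diag}(|K_1|,\dots,|K_N|)$ is the pressure mass matrix. $D=\mathrm{diag}(d_{11},0,\dots,0)\in\mathbb{R}^{N\times N}$ with $d_{11}>0$. *)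

(* Defs.v *)
From HB Require Import structures.
From mathcomp Require Import all_boot all_order all_algebra.
From mathcomp Require Import all_classical all_reals all_analysis.
Import Order.TTheory GRing.Theory Num.Theory.
Import numFieldNormedType.Exports.

Set Implicit Arguments.
Unset Strict Implicit.
Unset Printing Implicit Defensive.

Local Open Scope classical_set_scope.
Local Open Scope ring_scope.

(* Throughout, the space dimension is d = k.+1 (so that 'rV[R]_d carries its
   normed-space topology), and an m-simplex is given by its m.+1 vertices.
   Objects determined by a defining property (normals, weak gradients, matrices
   of bilinear forms) are taken with xget as the object having that property. *)

Section EuclideanGeometry.
Variable R : realType.

Definition dot n (u v : 'rV[R]_n) : R := (u *m v^T) 0 0.
Definition enorm n (u : 'rV[R]_n) : R := Num.sqrt (dot u u).
Definition eball n (c : 'rV[R]_n) (r : R) : set 'rV[R]_n :=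
  [set x | enorm (x - c) <= r].

Definition boundary (T : topologicalType) (O : set T) : set T :=
  closure O `\` interior O.

(* Convex hull of the points p i, i in s. *)
Definition hull n (I : finType) (p : I -> 'rV[R]_n) (s : {set I}) :
    set 'rV[R]_n :=
  [set x | exists a : I -> R,
     [/\ forall i, 0 <= a i, \sum_(i in s) a i = 1
       & x = \sum_(i in s) a i *: p i]].

(* Iterated integral of f over {t in R^m | t_i >= 0, t_1 + ... + t_m <= s}. *)
Fixpoint std_int (m : nat) : R -> ('rV[R]_m -> R) -> R :=
  if m is m'.+1 then
    fun s f => \int[lebesgue_measure]_(t in `[0, s])
      std_int (s - t) (fun y : 'rV_m' => f (row_mx (t%:M : 'rV_1) y))
  else fun _ f => f 0.

(* Edge vectors p_1 - p_0, ..., p_m - p_0, as rows. *)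
Definition edges m n (p : 'I_m.+1 -> 'rV[R]_n) : 'M[R]_(m, n) :=
  \matrix_(i < m) (p (lift ord0 i) - p ord0).

(* Integral over the m-simplex with vertices p, with respect to its
   m-dimensional surface measure, through the affine parametrization of the
   simplex by the reference simplex.  The area element is sqrt (det (E E^T)),
   which is |det E| if m = n. *)
Definition simplex_int m n (p : 'I_m.+1 -> 'rV[R]_n) (f : 'rV[R]_n -> R) : R :=
  Num.sqrt (\det (edges p *m (edges p)^T)) *
  std_int 1 (fun t : 'rV_m => f (p ord0 + t *m edges p)).

Definition simplex_measure m n (p : 'I_m.+1 -> 'rV[R]_n) : R :=
  simplex_int p (fun=> 1).

Definition divergence k (w : 'rV[R]_k.+1 -> 'rV[R]_k.+1) (x : 'rV[R]_k.+1) : R :=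
  \sum_(c < k.+1) 'D_(delta_mx 0 c) (fun y => w y 0 c) x.

End EuclideanGeometry.

(* Admissible triangulations in the sense of Ciarlet.  Vertex i of element K is
   coord (cell K i); facet i of K is the one opposite to vertex i, and is
   identified with the set of (the numbers of) its vertices. *)
Record simplicial_mesh (R : realType) (k : nat) (Omega : set 'rV[R]_k.+1) := Mesh {
  nvert : nat;
  npred : nat; (* number of elements minus one *)
  coord : 'I_nvert -> 'rV[R]_k.+1;
  cell : 'I_npred.+1 -> 'I_k.+2 -> 'I_nvert;
  coord_inj : injective coord;
  cell_nondegenerate : forall K, row_free (edges (fun i => coord (cell K i)));
  mesh_cover :
    closure Omega = \bigcup_(K in setT) hull coord [set cell K i | i : 'I_k.+2]%SET;
  mesh_disjoint : forall K K', K != K' ->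
    interior (hull coord [set cell K i | i : 'I_k.+2]%SET) `&`
    interior (hull coord [set cell K' i | i : 'I_k.+2]%SET) = set0;
  mesh_facets : forall K i,
    hull coord [set cell K j | j in [set~ i]]%SET `<=` boundary Omega \/
    exists K' i', K' != K /\
      [set cell K j | j in [set~ i]]%SET = [set cell K' j | j in [set~ i']]%SET }.

Section Mesh.
Variables (R : realType) (k : nat) (Omega : set 'rV[R]_k.+1).
Variable M : simplicial_mesh Omega.
Local Notation d := k.+1.
Local Notation elt := 'I_(npred M).+1.

Definition cell_pt (K : elt) (i : 'I_d.+1) : 'rV[R]_d := coord (cell K i).
Definition cell_set (K : elt) : set 'rV[R]_d :=
  hull (@coord _ _ _ M) [set cell K i | i : 'I_d.+1]%SET.
Definition cell_int (K : elt) (f : 'rV[R]_d -> R) : R := simplex_int (cell_pt K) f.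
Definition vol (K : elt) : R := simplex_measure (cell_pt K).

Definition facet (K : elt) (i : 'I_d.+1) : {set 'I_(nvert M)} :=
  [set cell K j | j in [set~ i]]%SET.
Definition facet_pt (K : elt) (i : 'I_d.+1) (j : 'I_d) : 'rV[R]_d :=
  cell_pt K (lift i j).
Definition facet_int (K : elt) (i : 'I_d.+1) (f : 'rV[R]_d -> R) : R :=
  simplex_int (facet_pt K i) f.
Definition area (K : elt) (i : 'I_d.+1) : R := simplex_measure (facet_pt K i).

Definition interior_facet (e : {set 'I_(nvert M)}) : bool :=
  [exists K : elt, exists i : 'I_d.+1, e == facet K i] &&
  ~~ `[< hull (@coord _ _ _ M) e `<=` boundary Omega >].

Definition is_outward_normal (K : elt) (i : 'I_d.+1) (n : 'rV[R]_d) : Prop :=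
  [/\ enorm n = 1,
      forall j j', dot n (facet_pt K i j - facet_pt K i j') = 0
    & forall j, dot n (cell_pt K i - facet_pt K i j) < 0].
Definition normal (K : elt) (i : 'I_d.+1) : 'rV[R]_d :=
  xget 0 [set n | is_outward_normal K i n].

Definition adjacent (K K' : elt) : bool :=
  (K != K') && [exists i, exists i',
    (facet K i == facet K' i') && interior_facet (facet K i)].
Definition connected_mesh : Prop := forall K K' : elt, connect adjacent K K'.

(* The mesh size is at most sigma times the radius of a ball inscribed in any
   given element. *)
Definition quasi_uniform (sigma : R) : Prop :=
  forall K' : elt, exists c r, 0 < r /\ eball c r `<=` cell_set K' /\
    forall (K : elt) x y, cell_set K x -> cell_set K y ->
      enorm (x - y) <= sigma * r.

(* Elements of RT_0, as functions on the whole of R^d. *)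
Definition RT0 (w : 'rV[R]_d -> 'rV[R]_d) : Prop :=
  exists (a : 'rV[R]_d) (b : R), w = fun x => a + b *: x.

(* g is the weak gradient on K of the scalar function with the value u0 inside K
   and the value ub i on facet i of K. *)
Definition is_weak_grad (K : elt) (u0 : R) (ub : 'I_d.+1 -> R)
    (g : 'rV[R]_d -> 'rV[R]_d) : Prop :=
  RT0 g /\ forall w, RT0 w ->
    cell_int K (fun x => dot (g x) (w x)) =
    \sum_i facet_int K i (fun x => ub i * dot (w x) (normal K i))
    - cell_int K (fun x => u0 * divergence w x).
Definition weak_grad (K : elt) (u0 : R) (ub : 'I_d.+1 -> R) :
    'rV[R]_d -> 'rV[R]_d :=
  xget (fun=> 0) [set g | is_weak_grad K u0 ub g].

(* Degrees of freedom of V_h^0: a component on an element or on an interior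
   facet.  V_h^0 itself is identified with 'cV[R]_ndof. *)
Definition dof : finType :=
  ((elt + {e : {set 'I_(nvert M)} | interior_facet e}) * 'I_d)%type.
Definition ndof : nat := #|dof|.

Definition cell_val (u : 'cV[R]_ndof) (K : elt) : 'rV[R]_d :=
  \row_c u (enum_rank ((inl K, c) : dof)) 0.
(* 0 if the facet e is on the boundary *)
Definition facet_val (u : 'cV[R]_ndof) (e : {set 'I_(nvert M)}) : 'rV[R]_d :=
  \row_c if insub e is Some e' then u (enum_rank ((inr e', c) : dof)) 0 else 0.

Definition weak_gradv (u : 'cV[R]_ndof) (K : elt) (x : 'rV[R]_d) : 'M[R]_d :=
  \matrix_(c < d)
    weak_grad K (cell_val u K 0 c) (fun i => facet_val u (facet K i) 0 c) x.

Definition stiffness_form (u v : 'cV[R]_ndof) : R :=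
  \sum_(K : elt) cell_int K (fun x => \tr (weak_gradv u K x *m (weak_gradv v K x)^T)).
Definition stiffness_mx : 'M[R]_ndof :=
  xget 0 [set A | forall u v, (v^T *m A *m u) 0 0 = stiffness_form u v].

Definition pressure_form (q : 'cV[R]_((npred M).+1)) (u : 'cV[R]_ndof) : R :=
  \sum_(K : elt) \sum_(i | interior_facet (facet K i))
    area K i * q K 0 * dot (facet_val u (facet K i)) (normal K i).
Definition pressure_mx : 'M[R]_((npred M).+1, ndof) :=
  xget 0 [set B | forall q u, (q^T *m B *m u) 0 0 = pressure_form q u].

Definition pressure_mass : 'M[R]_((npred M).+1) := diag_mx (\row_K vol K).
Definition regularization (d11 : R) : 'M[R]_((npred M).+1) :=
  d11 *: delta_mx ord0 ord0.

Definition saddle_mx (mu d11 : R) : 'M[R]_(ndof + (npred M).+1) :=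
  block_mx stiffness_mx (- pressure_mx^T)
           (- pressure_mx) (- (mu *: regularization d11)).

End Mesh.

Definition schur (R : realType) (m n : nat) (X : 'M[R]_(m + n)) : 'M[R]_n :=
  drsubmx X - dlsubmx X *m invmx (ulsubmx X) *m ursubmx X.

Definition symmetric_mx (R : realType) n (X : 'M[R]_n) : Prop := X^T = X.
Definition posdef_mx (R : realType) n (X : 'M[R]_n) : Prop :=
  forall x : 'cV[R]_n, x != 0 -> 0 < (x^T *m X *m x) 0 0.
Definition possemidef_mx (R : realType) n (X : 'M[R]_n) : Prop :=
  forall x : 'cV[R]_n, 0 <= (x^T *m X *m x) 0 0.
Definition loewner_le (R : realType) n (X Y : 'M[R]_n) : Prop :=
  symmetric_mx (Y - X) /\ possemidef_mx (Y - X).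

(* Main.v *)
Require Import Defs.
From HB Require Import structures.
From mathcomp Require Import all_boot all_order all_algebra.
From mathcomp Require Import all_classical all_reals all_analysis.
From mathcomp Require Import perm ring lra.
Import Order.TTheory GRing.Theory Num.Theory.
Import numFieldNormedType.Exports.
Local Open Scope classical_set_scope.
Local Open Scope ring_scope.
Set Implicit Arguments.
Unset Strict Implicit.
Unset Printing Implicit Defensive.

(* With [u = A^-1 B^T q] one has [u^T A u = q^T B u = q^T B A^-1 B^T q].  On each
   element [q^T B u] is the integral of [q_K tr (grad_w u)], so expanding
   [0 <= |grad_w u - q_K I|^2] gives [2 q^T B u <= d q^T M_p q + u^T A u], which is
   the upper bound.
   Definiteness is a matter of propagating zeros through the connected mesh.  For
   [A], a vanishing weak gradient, tested against [x - p_j], forces the values on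
   an element and on its facets to vanish as soon as one of them does, and some
   facet lies on the boundary.  For [S], [q_{K_1} = 0] and [B^T q = 0] propagate
   because a facet belongs to at most two elements. *)

(** Integrals are iterated Lebesgue integrals, but every integrand that occurs is a polynomial of
    degree at most 2 in the parameters of the simplex: components of RT_0 fields are affine, and at
    most two of them are multiplied. A closed formula for such integrals gives linearity, positivity
    and definiteness of the L^2 product. Normals, weak gradients and matrices are chosen by [xget],
    so the existence of each has to be proved before its defining property can be used. The mesh
    axioms state neither that a facet lies in at most two elements nor that some facet lies on the
    boundary. Both come from the disjointness of interiors (the second together with [mesh_facets]),
    with the sign of a barycentric coordinate telling on which side of a facet a point lies. The
    factor [d] of the upper bound is |I|^2. *)

Lemma Rintegral_horner (R : realType) (s : R) (p q : {poly R}) :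
  0 <= s -> q^`() = p ->
  \int[lebesgue_measure]_(t in `[0, s]) p.[t] = q.[s] - q.[0].
Proof.
rewrite le_eqVlt => /predU1P[<- _|s0 dq].
  by rewrite set_itv1 Rintegral_set1 subrr.
rewrite /Rintegral (@continuous_FTC2 _ _ (horner q)) //.
- by apply: continuous_subspaceT => x; exact: continuous_horner.
- split => [x _||]; first exact: ex_derive.
  + exact/cvg_at_right_filter/continuous_horner.
  + exact/cvg_at_left_filter/continuous_horner.
- by move=> x _; rewrite derive1E derive_val dq.
Qed.

(** * Quadratic polynomials on the standard simplex *)

Section QuadraticIntegral.
Variable R : realType.

Definition quadf m (c : R) (l : 'I_m -> R) (Q : 'I_m -> 'I_m -> R)
    (t : 'rV[R]_m) : R :=
  c + \sum_j l j * t 0 j + \sum_j \sum_k Q j k * (t 0 j * t 0 k).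

(** The volume of the n-dimensional standard simplex of size [s]; it is the derivative in [s] of the
    next one. *)
Definition fpow (n : nat) (s : R) : R := s ^+ n / n`!%:R.

Lemma quadf_row_mx m c (l : 'I_m.+1 -> R) Q (t : R) (y : 'rV[R]_m) :
  quadf c l Q (row_mx (t%:M : 'rV_1) y) =
  quadf (c + l ord0 * t + Q ord0 ord0 * t ^+ 2)
    (fun j => l (lift ord0 j)
              + (Q ord0 (lift ord0 j) + Q (lift ord0 j) ord0) * t)
    (fun j k => Q (lift ord0 j) (lift ord0 k)) y.
Proof.
have e0 : row_mx (t%:M : 'rV_1) y 0 ord0 = t.
  have -> : ord0 = lshift m (ord0 : 'I_1) by apply: val_inj.
  by rewrite row_mxEl mxE eqxx.
have eS j : row_mx (t%:M : 'rV_1) y 0 (lift ord0 j) = y 0 j.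
  have -> : lift ord0 j = rshift 1 j by apply: val_inj.
  by rewrite row_mxEr.
rewrite /quadf !big_ord_recl e0.
have -> : \sum_i l (lift ord0 i) * row_mx (t%:M : 'rV_1) y 0 (lift ord0 i)
   = \sum_i l (lift ord0 i) * y 0 i by apply: eq_bigr => i _; rewrite eS.
have -> : \sum_k Q ord0 (lift ord0 k) * (t * row_mx (t%:M : 'rV_1) y 0 (lift ord0 k))
   = \sum_k Q ord0 (lift ord0 k) * t * y 0 k.
  by apply: eq_bigr => i _; rewrite eS mulrA.
have -> : \sum_i \sum_k Q (lift ord0 i) k *
     (row_mx (t%:M : 'rV_1) y 0 (lift ord0 i) * row_mx (t%:M : 'rV_1) y 0 k)
   = \sum_i Q (lift ord0 i) ord0 * t * y 0 i
     + \sum_i \sum_k Q (lift ord0 i) (lift ord0 k) * (y 0 i * y 0 k).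
  rewrite -big_split /=; apply: eq_bigr => i _.
  rewrite big_ord_recl e0 eS; congr (_ + _); first by ring.
  by apply: eq_bigr => k _; rewrite eS.
have -> : \sum_j (l (lift ord0 j)
              + (Q ord0 (lift ord0 j) + Q (lift ord0 j) ord0) * t) * y 0 j
  = \sum_j l (lift ord0 j) * y 0 j + \sum_j Q ord0 (lift ord0 j) * t * y 0 j
    + \sum_j Q (lift ord0 j) ord0 * t * y 0 j.
  by rewrite -!big_split /=; apply: eq_bigr => j _; ring.
ring.
Qed.

Lemma Rintegral_fpow (n : nat) (s c0 c1 c2 d0 d1 e : R) : 0 <= s ->
  \int[lebesgue_measure]_(t in `[0, s])
    ((c0 + c1 * t + c2 * t ^+ 2) * fpow n (s - t)
     + (d0 + d1 * t) * fpow n.+1 (s - t) + e * fpow n.+2 (s - t)) =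
  c0 * fpow n.+1 s + (c1 + d0) * fpow n.+2 s + (c2 *+ 2 + d1 + e) * fpow n.+3 s.
Proof.
move=> s0.
pose P i : {poly R} := i`!%:R^-1 *: (s%:P - 'X) ^+ i.
have Pe i t : (P i).[t] = fpow i (s - t).
  by rewrite /P /fpow !hornerE mulrC.
have dP i : (P i.+1)^`() = - P i.
  rewrite /P derivZ deriv_exp derivB derivC derivX sub0r /=.
  rewrite mulN1r mulNrn scalerN -[X in _ *: X]scaler_nat scalerA; congr (- (_ *: _)).
  by rewrite factS natrM invfM mulrAC mulVf ?mul1r // pnatr_eq0.
clearbody P.
(* Repeated integration by parts: differentiate the polynomial factors and raise the index of [P].
   All [P] with positive index vanish at [s], so only the value at 0 survives. *)
pose q : {poly R} :=
  - ((c0%:P + c1 *: 'X + c2 *: 'X^2) * P n.+1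
   + (c1%:P + (c2 *+ 2) *: 'X + d0%:P + d1 *: 'X) * P n.+2
   + ((c2 *+ 2)%:P + d1%:P + e%:P) * P n.+3).
pose p : {poly R} :=
  (c0%:P + c1 *: 'X + c2 *: 'X^2) * P n + (d0%:P + d1 *: 'X) * P n.+1 + e%:P * P n.+2.
have dq : q^`() = p.
  rewrite /q /p derivN !(derivD, derivM, derivC, derivZ, derivX, derivXn) !dP /=.
  rewrite -!mul_polyC !polyCMn; ring.
transitivity (\int[lebesgue_measure]_(t in `[0, s]) p.[t])%R.
  by apply: eq_Rintegral => t _; rewrite /p !(hornerE, Pe).
rewrite (Rintegral_horner s0 dq) /q !(hornerE, Pe) !subrr !subr0.
rewrite /fpow !expr0n /=; ring.
Qed.

(** The moments of the simplex: [t_j t_k] integrates to s^(m+2)/(m+2)! for distinct indices and to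
    twice that for equal ones, hence the extra diagonal sum. *)
Lemma std_int_quadf m s c (l : 'I_m -> R) Q : 0 <= s ->
  std_int s (quadf c l Q) =
  c * fpow m s + (\sum_j l j) * fpow m.+1 s
  + (\sum_j \sum_k Q j k + \sum_j Q j j) * fpow m.+2 s.
Proof.
elim: m s c l Q => [|m IH] s c l Q s0 /=.
  by rewrite /quadf !big_ord0 /fpow expr0 fact0 divr1; ring.
set l' := fun j => l (lift ord0 j).
set C := \sum_j (Q ord0 (lift ord0 j) + Q (lift ord0 j) ord0).
set Q' := fun j k => Q (lift ord0 j) (lift ord0 k).
set q := \sum_j \sum_k Q' j k + \sum_j Q' j j.
transitivity (\int[lebesgue_measure]_(t in `[0, s])
    ((c + l ord0 * t + Q ord0 ord0 * t ^+ 2) * fpow m (s - t)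
     + (\sum_j l' j + C * t) * fpow m.+1 (s - t) + q * fpow m.+2 (s - t)))%R;
  last first.
  rewrite Rintegral_fpow // /q /C /l' /Q' !big_ord_recl.
  under [X in _ = _ + (_ + X + _) * _]eq_bigr => i _ do rewrite big_ord_recl.
  by rewrite !big_split /=; ring.
apply: eq_Rintegral => t /set_mem; rewrite /= in_itv /= => /andP[t0 ts].
under eq_fun => y do rewrite quadf_row_mx.
rewrite IH ?subr_ge0 //; congr (_ + _ * _ + _).
by rewrite /C mulr_suml -big_split.
Qed.

Lemma quadfD m c (l : 'I_m -> R) Q c' l' Q' :
  (fun x => quadf c l Q x + quadf c' l' Q' x) =
  quadf (c + c') (fun j => l j + l' j) (fun j k => Q j k + Q' j k).
Proof.
apply/funext => x; rewrite /quadf.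
under [in RHS]eq_bigr => j _ do rewrite mulrDl.
under [X in _ = _ + X]eq_bigr => j _ do
  (under eq_bigr => k _ do rewrite mulrDl; rewrite big_split).
by rewrite !big_split /=; ring.
Qed.

Lemma quadfZ m a c (l : 'I_m -> R) Q :
  (fun x => a * quadf c l Q x) =
  quadf (a * c) (fun j => a * l j) (fun j k => a * Q j k).
Proof.
apply/funext => x; rewrite /quadf !mulrDr !mulr_sumr.
congr (_ + _ + _); first by apply: eq_bigr => j _; rewrite mulrA.
by apply: eq_bigr => j _; rewrite mulr_sumr; apply: eq_bigr => k _; rewrite mulrA.
Qed.

Lemma quadf_affineM m a b (u v : 'I_m -> R) :
  (fun x : 'rV_m => (a + \sum_j u j * x 0 j) * (b + \sum_j v j * x 0 j)) =
  quadf (a * b) (fun j => a * v j + b * u j) (fun j k => u j * v k).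
Proof.
apply/funext => x; rewrite /quadf mulrDl !mulrDr !mulr_suml !mulr_sumr.
have -> : \sum_j (a * v j + b * u j) * x 0 j =
    \sum_j a * (v j * x 0 j) + \sum_j u j * x 0 j * b.
  by rewrite -big_split; apply: eq_bigr => j _ /=; ring.
rewrite !addrA; congr (_ + _); apply: eq_bigr => j _.
by rewrite mulr_sumr; apply: eq_bigr => k _; ring.
Qed.

Lemma quadf_cst m a : quadf a (fun=> 0) (fun _ _ : 'I_m => 0) = fun=> a.
Proof.
apply/funext => x; rewrite /quadf.
rewrite !big1 ?addr0 // => [i _|i _]; last by rewrite mul0r.
by rewrite big1 // => j _; rewrite mul0r.
Qed.

(** The class of integrands on which linearity of [std_int] is read off the closed formula, without
    integrability arguments. *)
Definition is_quad m (f : 'rV[R]_m -> R) : Prop :=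
  exists c l Q, f = quadf c l Q.

Lemma is_quadD m (f g : 'rV[R]_m -> R) :
  is_quad f -> is_quad g -> is_quad (fun x => f x + g x).
Proof. by move=> [c [l [Q ->]]] [c' [l' [Q' ->]]]; rewrite quadfD; do 3!eexists. Qed.

Lemma is_quadZ m a (f : 'rV[R]_m -> R) :
  is_quad f -> is_quad (fun x => a * f x).
Proof. by move=> [c [l [Q ->]]]; rewrite quadfZ; do 3!eexists. Qed.

Lemma is_quad_cst m a : is_quad (fun _ : 'rV[R]_m => a).
Proof. by rewrite -quadf_cst; do 3!eexists. Qed.

Lemma std_intD m (f g : 'rV[R]_m -> R) : is_quad f -> is_quad g ->
  std_int 1 (fun x => f x + g x) = std_int 1 f + std_int 1 g.
Proof.
move=> [c [l [Q ->]]] [c' [l' [Q' ->]]].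
rewrite quadfD !std_int_quadf //.
under [\sum_j \sum_k (_ + _)]eq_bigr => j _ do rewrite big_split.
by rewrite !big_split /=; ring.
Qed.

Lemma std_intZ m a (f : 'rV[R]_m -> R) : is_quad f ->
  std_int 1 (fun x => a * f x) = a * std_int 1 f.
Proof.
move=> [c [l [Q ->]]]; rewrite quadfZ !std_int_quadf //.
under [\sum_j \sum_k (_ * _)]eq_bigr => j _ do rewrite -mulr_sumr.
by rewrite -!mulr_sumr; ring.
Qed.

Lemma std_int_cst m a : std_int 1 (fun _ : 'rV[R]_m => a) = a / m`!%:R.
Proof.
rewrite -quadf_cst.
by rewrite std_int_quadf // !big1 ?(mul0r, addr0) // /fpow ?expr1n ?mul1r //.
Qed.

(** An affine function takes the values [a] and [a + u j] at the vertices. Its square integrates to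
    the sum of the squared vertex values plus the square of their sum, over (m+2)!; in this form
    positivity and definiteness are visible. *)
Lemma std_int_sqr m a (u : 'I_m -> R) :
  std_int 1 (fun x : 'rV_m => (a + \sum_j u j * x 0 j) * (a + \sum_j u j * x 0 j)) =
  (a ^+ 2 + \sum_j (a + u j) ^+ 2 + (a + \sum_j (a + u j)) ^+ 2) / m.+2`!%:R.
Proof.
rewrite quadf_affineM std_int_quadf // /fpow !expr1n.
under [\sum_j \sum_k (_ * _)]eq_bigr => j _ do rewrite -mulr_sumr.
rewrite -mulr_suml.
have -> : \sum_j (a + u j) ^+ 2 = m%:R * a ^+ 2 + 2 * a * \sum_j u j + \sum_j u j * u j.
  rewrite mulr_sumr mulr_natl -{5}[m]card_ord -sumr_const -!big_split /=.
  by apply: eq_bigr => j _; ring.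
rewrite !big_split /= -mulr_sumr sumr_const card_ord -[a *+ m]mulr_natl.
have f0 : m`!%:R != 0 :> R by rewrite pnatr_eq0 -lt0n fact_gt0.
have m1 : m.+1%:R != 0 :> R by rewrite pnatr_eq0.
have m2 : m.+2%:R != 0 :> R by rewrite pnatr_eq0.
rewrite !factS !natrM; move: f0 m1 m2; rewrite -[m.+2]addn2 -[m.+1]addn1 !natrD.
move: (m`!%:R) => F F0 m1 m2; field.
by rewrite F0 m1 m2.
Qed.

Lemma std_int_sqr_ge0 m a (u : 'I_m -> R) :
  0 <= std_int 1 (fun x : 'rV_m => (a + \sum_j u j * x 0 j) * (a + \sum_j u j * x 0 j)).
Proof.
by rewrite std_int_sqr divr_ge0 // !addr_ge0 ?sqr_ge0 ?sumr_ge0 // => i _; exact: sqr_ge0.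
Qed.

Lemma std_int_sqr_eq0 m a (u : 'I_m -> R) :
  std_int 1 (fun x : 'rV_m => (a + \sum_j u j * x 0 j) * (a + \sum_j u j * x 0 j)) = 0 ->
  a = 0 /\ forall j, u j = 0.
Proof.
rewrite std_int_sqr => /eqP; rewrite mulf_eq0 invr_eq0 pnatr_eq0 -leqn0 leqNgt fact_gt0 orbF.
have s0 : 0 <= \sum_j (a + u j) ^+ 2 by apply: sumr_ge0 => j _; exact: sqr_ge0.
rewrite !paddr_eq0 ?addr_ge0 ?sqr_ge0 // => /andP[/andP[]].
rewrite sqrf_eq0 => /eqP a0; rewrite psumr_eq0 => [/allP h _|j _]; last exact: sqr_ge0.
split=> // j; have := h j; rewrite mem_index_enum a0 add0r sqrf_eq0 => /(_ isT) /eqP.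
exact.
Qed.
End QuadraticIntegral.

(** * Scalar products and representation of bilinear forms *)

Section BilinearForms.
Variable R : realType.

Lemma dotE n (u v : 'rV[R]_n) : dot u v = \sum_c u 0 c * v 0 c.
Proof. by rewrite /dot mxE; apply: eq_bigr => c _; rewrite mxE. Qed.

Lemma dotC n (u v : 'rV[R]_n) : dot u v = dot v u.
Proof. by rewrite !dotE; apply: eq_bigr => c _; rewrite mulrC. Qed.

Lemma dotDl n (u v w : 'rV[R]_n) : dot (u + v) w = dot u w + dot v w.
Proof. by rewrite /dot mulmxDl mxE. Qed.

Lemma dotZl n a (u w : 'rV[R]_n) : dot (a *: u) w = a * dot u w.
Proof. by rewrite /dot -scalemxAl mxE. Qed.

Lemma dotDr n (u v w : 'rV[R]_n) : dot w (u + v) = dot w u + dot w v.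
Proof. by rewrite dotC dotDl !(dotC w). Qed.

Lemma dotZr n a (u w : 'rV[R]_n) : dot w (a *: u) = a * dot w u.
Proof. by rewrite dotC dotZl (dotC w). Qed.

Lemma dotNl n (u w : 'rV[R]_n) : dot (- u) w = - dot u w.
Proof. by rewrite -scaleN1r dotZl mulN1r. Qed.

Lemma dot_ge0 n (u : 'rV[R]_n) : 0 <= dot u u.
Proof. by rewrite dotE; apply: sumr_ge0 => c _; rewrite -expr2 sqr_ge0. Qed.

Lemma dot_eq0 n (u : 'rV[R]_n) : dot u u = 0 -> u = 0.
Proof.
rewrite dotE => /eqP; rewrite psumr_eq0 => [/allP h|c _]; last first.
  by rewrite -expr2 sqr_ge0.
apply/rowP => c; rewrite mxE; apply/eqP.
by have := h c; rewrite mem_index_enum mulf_eq0 orbb => /(_ isT).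
Qed.

Lemma scalar_colE n (f : 'cV[R]_n -> R) : scalar f ->
  forall u, f u = \sum_i u i 0 * f (delta_mx i 0).
Proof.
move=> lf; pose F : {scalar 'cV[R]_n} :=
  HB.pack f (GRing.isLinear.Build _ _ _ _ f lf).
move=> u; rewrite -[f]/(F : _ -> _) {1}(matrix_sum_delta u) linear_sum.
by apply: eq_bigr => i _; rewrite big_ord1 linearZ.
Qed.

(** Provides the existence behind the [xget] in the stiffness and pressure matrices. *)
Lemma bilinear_mx m n (b : 'cV[R]_n -> 'cV[R]_m -> R) :
  (forall v, scalar (b^~ v)) -> (forall u, scalar (b u)) ->
  exists A : 'M[R]_(m, n), forall u v, (v^T *m A *m u) 0 0 = b u v.
Proof.
move=> bl br; exists (\matrix_(i, j) b (delta_mx j 0) (delta_mx i 0)) => u v.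
rewrite (scalar_colE (bl v)) mxE; apply: eq_bigr => j _.
rewrite mulrC (scalar_colE (br _)) mxE; congr (_ * _).
by apply: eq_bigr => i _; rewrite !mxE.
Qed.

Lemma posdef_mx_unit n (A : 'M[R]_n) : posdef_mx A -> A \in unitmx.
Proof.
move=> pA; rewrite unitmxE unitfE; apply/negP => /det0P[v v0 vA].
have := pA v^T; rewrite trmx_eq0 => /(_ v0).
by rewrite trmxK vA mul0mx mxE ltxx.
Qed.

Lemma riesz n (b : 'cV[R]_n -> 'cV[R]_n -> R) (L : 'cV[R]_n -> R) :
  (forall v, scalar (b^~ v)) -> (forall u, scalar (b u)) ->
  (forall u, u != 0 -> 0 < b u u) -> scalar L ->
  exists u, forall v, b u v = L v.
Proof.
move=> bl br bp sL; have [A bA] := bilinear_mx bl br.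
have Au : A \in unitmx by apply: posdef_mx_unit => u u0; rewrite bA bp.
exists (invmx A *m \col_i L (delta_mx i 0)) => v.
rewrite -bA mulmxA mulmxK // (scalar_colE sL) mxE.
by apply: eq_bigr => i _; rewrite !mxE.
Qed.

End BilinearForms.

(** * Raviart-Thomas fields *)

Section RaviartThomas.
Variables (R : realType) (k : nat).
Local Notation d := k.+1.
Implicit Types (w g : 'rV[R]_d -> 'rV[R]_d).

Lemma RT0_cst (a : 'rV[R]_d) : RT0 (fun=> a).
Proof. by exists a, 0; apply/funext => x; rewrite scale0r addr0. Qed.

Lemma RT0_lin a w w' : RT0 w -> RT0 w' -> RT0 (fun x => a *: w x + w' x).
Proof.
move=> [u [b ->]] [u' [b' ->]]; exists (a *: u + u'), (a * b + b').
by apply/funext => x; rewrite scalerDr scalerDl scalerA addrACA.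
Qed.

(** Coordinates on RT_0, constant part above slope, which let the column-vector form of the Riesz
    theorem apply. *)
Definition rt (th : 'cV[R]_(d + 1)) (x : 'rV[R]_d) : 'rV[R]_d :=
  (usubmx th)^T + dsubmx th 0 0 *: x.

Lemma rtP w : RT0 w <-> exists th, w = rt th.
Proof.
split=> [[a [b ->]]|[th ->]]; last by do 2!eexists.
by exists (col_mx a^T b%:M); rewrite /rt col_mxKu col_mxKd trmxK mxE eqxx mulr1n.
Qed.

Lemma rt_lin a th th' : rt (a *: th + th') = fun x => a *: rt th x + rt th' x.
Proof.
by apply/funext => x; apply/rowP => c; rewrite !mxE; ring.
Qed.

Lemma divergence_RT0 (a : 'rV[R]_d) (b : R) (x : 'rV[R]_d) :
  divergence (fun x => a + b *: x) x = d%:R * b.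
Proof.
rewrite /divergence -[d in RHS]card_ord mulr_natl -sumr_const.
apply: eq_bigr => c _.
apply: cvg_lim => //; apply: cvg_near_cst; near=> h.
have h0 : h != 0 by near: h; exact: nbhs_dnbhs_neq.
rewrite /= !mxE !eqxx mulr1 [LHS]mulrC.
by field.
Unshelve. all: by end_near. Qed.

End RaviartThomas.

(** * Integrals of Raviart-Thomas fields over a simplex *)

Section SimplexIntegral.
Variables (R : realType) (k : nat).
Local Notation d := k.+1.

Lemma std_int_sum (I : finType) m (f : I -> 'rV[R]_m -> R) :
  (forall i, is_quad (f i)) -> is_quad (fun x => \sum_i f i x) /\
  std_int 1 (fun x => \sum_i f i x) = \sum_i std_int 1 (f i).
Proof.
move=> fq; elim: (index_enum I) => [|i r [IHq IH]].
  have -> : (fun x => \sum_(i <- [::]) f i x) = fun=> 0.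
    by apply/funext => x; rewrite big_nil.
  by rewrite std_int_cst mul0r big_nil; split=> //; exact: is_quad_cst.
have -> : (fun x => \sum_(j <- i :: r) f j x) = fun x => f i x + \sum_(j <- r) f j x.
  by apply/funext => x; rewrite big_cons.
by rewrite std_intD // IH big_cons; split=> //; exact: is_quadD.
Qed.

Variables (m : nat) (p : 'I_m.+1 -> 'rV[R]_d).

Definition simplex_param (t : 'rV[R]_m) : 'rV[R]_d := p ord0 + t *m edges p.

Lemma rt_param (a : 'rV[R]_d) (b : R) c t :
  (a + b *: simplex_param t) 0 c =
  (a 0 c + b * p ord0 0 c) + \sum_j (b * edges p j c) * t 0 j.
Proof.
rewrite /simplex_param !mxE mulrDr addrA mulr_sumr; congr (_ + _).
by apply: eq_bigr => j _; ring.
Qed.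

Lemma is_quad_coordM g w c : RT0 g -> RT0 w ->
  is_quad (fun t => g (simplex_param t) 0 c * w (simplex_param t) 0 c).
Proof.
move=> [a [b ->]] [a' [b' ->]].
under eq_fun => t do rewrite !rt_param.
by rewrite quadf_affineM; do 3!eexists.
Qed.

Lemma is_quad_dot g w : RT0 g -> RT0 w ->
  is_quad (fun t => dot (g (simplex_param t)) (w (simplex_param t))).
Proof.
move=> hg hw; under eq_fun => t do rewrite dotE.
by apply: (proj1 (std_int_sum _)) => c; exact: is_quad_coordM.
Qed.

Lemma simplex_int_dotlin a g g' w : RT0 g -> RT0 g' -> RT0 w ->
  simplex_int p (fun x => dot (a *: g x + g' x) (w x)) =
  a * simplex_int p (fun x => dot (g x) (w x))
  + simplex_int p (fun x => dot (g' x) (w x)).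
Proof.
move=> hg hg' hw; rewrite /simplex_int.
under eq_fun => t do rewrite dotDl dotZl.
have q1 := is_quad_dot hg hw; have q2 := is_quad_dot hg' hw.
by rewrite std_intD ?std_intZ //; [ring|exact: is_quadZ].
Qed.

Lemma simplex_int_dot_sum (I : finType) (g w : I -> 'rV[R]_d -> 'rV[R]_d) :
  (forall i, RT0 (g i)) -> (forall i, RT0 (w i)) ->
  simplex_int p (fun x => \sum_i dot (g i x) (w i x)) =
  \sum_i simplex_int p (fun x => dot (g i x) (w i x)).
Proof.
move=> hg hw; rewrite /simplex_int -mulr_sumr; congr (_ * _).
apply: (proj2 (@std_int_sum I m
  (fun i t => dot (g i (simplex_param t)) (w i (simplex_param t))) _)) => i.
exact: is_quad_dot.
Qed.

Lemma simplex_intZ a g w : RT0 g -> RT0 w ->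
  simplex_int p (fun x => a * dot (g x) (w x)) =
  a * simplex_int p (fun x => dot (g x) (w x)).
Proof.
move=> hg hw; have q := is_quad_dot hg hw.
by rewrite /simplex_int std_intZ //; ring.
Qed.

Lemma simplex_int_on_cst f c : (forall t, f (simplex_param t) = c) ->
  simplex_int p f = c * simplex_measure p.
Proof.
move=> fc; rewrite /simplex_measure /simplex_int.
rewrite (_ : (fun t => _) = fun=> c); last exact/funext.
by rewrite !std_int_cst; ring.
Qed.

Lemma simplex_int_sqr_ge0 w : RT0 w -> 0 <= simplex_int p (fun x => dot (w x) (w x)).
Proof.
move=> hw; rewrite /simplex_int mulr_ge0 ?sqrtr_ge0 //.
under eq_fun => t do rewrite dotE.
rewrite (proj2 (std_int_sum _)) => [|c]; last exact: is_quad_coordM.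
apply: sumr_ge0 => c _; move: hw => [a [b ->]].
by under eq_fun => t do rewrite !rt_param; exact: std_int_sqr_ge0.
Qed.

Lemma simplex_measure_gt0 : 0 < \det (edges p *m (edges p)^T) -> 0 < simplex_measure p.
Proof.
move=> h; rewrite /simplex_measure /simplex_int std_int_cst mul1r.
by rewrite mulr_gt0 ?sqrtr_gt0 // invr_gt0 ltr0n fact_gt0.
Qed.

(** Each component is affine in the parameters with slopes [b * edges p j c]; these vanish, and a
    nonzero edge entry then forces [b = 0]. *)
Lemma simplex_int_sqr_eq0 w : edges p != 0 -> 0 < \det (edges p *m (edges p)^T) ->
  RT0 w -> simplex_int p (fun x => dot (w x) (w x)) = 0 -> w = fun=> 0.
Proof.
move=> e0 de hw /eqP; rewrite /simplex_int mulf_eq0 sqrtr_eq0 leNgt de /=.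
under eq_fun => t do rewrite dotE.
rewrite (proj2 (std_int_sum _)) => [|c]; last exact: is_quad_coordM.
move: hw => [a [b ->]].
rewrite psumr_eq0 => [/allP h|c _]; last first.
  by under eq_fun => t do rewrite !rt_param; exact: std_int_sqr_ge0.
have {}h c : a 0 c + b * p ord0 0 c = 0 /\ forall j, b * edges p j c = 0.
  apply: std_int_sqr_eq0; have := h c; rewrite mem_index_enum => /(_ isT) /eqP.
  by under eq_fun => t do rewrite !rt_param.
have b0 : b = 0.
  apply/eqP/negPn/negP => b0; move/negP: e0; apply; apply/eqP/matrixP => j c.
  by have [_ /(_ j) /eqP] := h c; rewrite mulf_eq0 (negPf b0) /= => /eqP ->; rewrite mxE.
apply/funext => x; rewrite b0 scale0r addr0; apply/rowP => c; rewrite mxE.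
by have [] := h c; rewrite b0 mul0r addr0.
Qed.

End SimplexIntegral.

(** * Barycentric coordinates *)

Section Barycentric.
Variables (R : realType) (k : nat).
Local Notation d := k.+1.
Implicit Types (x y : 'rV[R]_d) (p q : 'I_d.+1 -> 'rV[R]_d).

(** Prepending 1 turns affine combinations into linear ones, so barycentric coordinates come from
    inverting one matrix and are defined on the whole space. *)
Definition hom x : 'rV[R]_d.+1 := row_mx (1%:M : 'rV_1) x.
Definition vertex_mx p : 'M[R]_d.+1 := \matrix_i hom (p i).
Definition bary p i x : R := (hom x *m invmx (vertex_mx p)) 0 i.

Lemma hom0 x : hom x 0 ord0 = 1.
Proof.
transitivity (hom x 0 (lshift d (ord0 : 'I_1))).
  by congr (hom x _ _); exact: val_inj.
by apply: etrans (row_mxEl _ _ _ _) _; rewrite mxE eqxx.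
Qed.

Lemma homS x c : hom x 0 (lift ord0 c) = x 0 c.
Proof.
transitivity (hom x 0 (rshift 1 c)).
  by congr (hom x _ _); exact: val_inj.
exact: row_mxEr.
Qed.

Lemma vertex_mxE p i j : vertex_mx p i j = hom (p i) 0 j.
Proof. by rewrite mxE. Qed.

(** A vector in the left kernel is an affine dependence between the vertices: its weights sum to 0,
    so it becomes a linear dependence between the edges. *)
Lemma vertex_mx_unit p : row_free (edges p) -> vertex_mx p \in unitmx.
Proof.
move=> ef; rewrite unitmxE unitfE; apply/negP => /det0P[c c0 cX].
have s0 : \sum_i c 0 i = 0.
  move/rowP : cX => /(_ ord0); rewrite [LHS]mxE [RHS]mxE => h; rewrite -[RHS]h.
  by apply: eq_bigr => i _; rewrite vertex_mxE hom0 mulr1.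
have sp : \sum_i c 0 i *: p i = 0.
  apply/rowP => j; move/rowP : cX => /(_ (lift ord0 j)); rewrite [LHS]mxE !mxE summxE => h; rewrite -[RHS]h.
  by apply: eq_bigr => i _; rewrite [LHS]mxE vertex_mxE homS.
have : (\row_j c 0 (lift ord0 j)) *m edges p == 0.
  apply/eqP; rewrite mulmx_sum_row -[RHS]sp [RHS]big_ord_recl.
  have -> : c 0 ord0 = - \sum_j c 0 (lift ord0 j).
    by apply/eqP; rewrite -addr_eq0 -big_ord_recl s0.
  rewrite scaleNr scaler_suml -sumrN -big_split /=.
  by apply: eq_bigr => j _; rewrite rowK !mxE scalerBr addrC.
rewrite mulmx_free_eq0 // => /eqP/rowP c'.
move/negP: c0; apply; apply/eqP/rowP => i; rewrite mxE.
have cS j : c 0 (lift ord0 j) = 0 by have := c' j; rewrite !mxE.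
case: (unliftP ord0 i) => [j ->|->] //.
by move: s0; rewrite big_ord_recl big1 ?addr0.
Qed.

Section Simplex.
Variable p : 'I_d.+1 -> 'rV[R]_d.
Hypothesis p_unit : vertex_mx p \in unitmx.

Lemma bary_vertex i j : bary p i (p j) = (i == j)%:R.
Proof.
rewrite /bary (_ : hom (p j) = row j (vertex_mx p)); last by rewrite rowK.
by rewrite -row_mul mulmxV // !mxE eq_sym.
Qed.

Lemma bary_hom x : \row_i bary p i x *m vertex_mx p = hom x.
Proof.
rewrite (_ : \row_i _ = hom x *m invmx (vertex_mx p)) ?mulmxKV //.
by apply/rowP => i; rewrite mxE.
Qed.

Lemma sum_bary x : \sum_i bary p i x = 1.
Proof.
rewrite -[RHS](hom0 x) -bary_hom mxE.
by apply: eq_bigr => i _; rewrite vertex_mxE hom0 mulr1 mxE.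
Qed.

Lemma bary_sum x : x = \sum_i bary p i x *: p i.
Proof.
apply/rowP => c; rewrite -homS -bary_hom mxE summxE.
by apply: eq_bigr => i _; rewrite vertex_mxE homS !mxE.
Qed.

Lemma bary_comb (I : finType) (a : I -> R) (y : I -> 'rV[R]_d) i :
  \sum_j a j = 1 -> bary p i (\sum_j a j *: y j) = \sum_j a j * bary p i (y j).
Proof.
move=> a1; rewrite /bary.
have -> : hom (\sum_j a j *: y j) = \sum_j a j *: hom (y j).
  apply/rowP => c; rewrite summxE; case: (unliftP ord0 c) => [c' ->|->].
    by rewrite homS summxE; apply: eq_bigr => j _; rewrite [RHS]mxE homS mxE.
  by rewrite hom0 -a1; apply: eq_bigr => j _; rewrite [RHS]mxE hom0 mulr1.
rewrite mulmx_suml summxE; apply: eq_bigr => j _.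
by rewrite -scalemxAl mxE.
Qed.

Lemma bary_conv e x y i :
  bary p i ((1 - e) *: x + e *: y) = (1 - e) * bary p i x + e * bary p i y.
Proof.
have := @bary_comb bool (fun b => if b then 1 - e else e)
  (fun b => if b then x else y) i.
by rewrite !big_bool /= subrK => /(_ erefl).
Qed.

Lemma bary_continuous i : continuous (bary p i).
Proof.
have -> : bary p i = fun x => invmx (vertex_mx p) ord0 i +
    \sum_c x 0 c * invmx (vertex_mx p) (lift ord0 c) i.
  apply/funext => x; rewrite /bary mxE big_ord_recl hom0 mul1r; congr (_ + _).
  by apply: eq_bigr => c _; rewrite homS.
move=> x; apply: (@cvgD _ _ _ (nbhs x)); first exact: cvg_cst.
apply: cvg_big => [|c _]; first exact: add_continuous.
by apply: (@cvgM _ _ (nbhs x)); [exact: coord_continuous|exact: cvg_cst].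
Qed.

Lemma bary_pos_open : open [set x | forall i, 0 < bary p i x].
Proof.
rewrite openE => x /= x0.
apply: (@filter_forall _ _ (fun i y => 0 < bary p i y) (nbhs x)) => i.
exact: (cvgr_gt _ (@bary_continuous i x) _ (x0 i)).
Qed.

(* Cramer's rule, up to the order of the vertices. *)
Lemma det_vertex_mx_replace q i i' (f : 'I_d.+1 -> 'I_d.+1) :
  f i = i' -> injective f -> (forall j, j != i -> q (f j) = p j) ->
  `|\det (vertex_mx q)| = `|bary p i (q i')| * `|\det (vertex_mx p)|.
Proof.
move=> fi fI qf; pose s := perm fI.
have -> : `|\det (vertex_mx q)| = `|\det (row_perm s (vertex_mx q))|.
  by rewrite row_permE det_mulmx det_perm normrM normrX normrN1 expr1n mul1r.
(* The rows of [C] are the barycentric coordinates of the vertices of [q]. All but row [i] are unit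
   vectors, so the determinant is the diagonal entry of row [i]. *)
pose C := row_perm s (vertex_mx q) *m invmx (vertex_mx p).
have -> : row_perm s (vertex_mx q) = C *m vertex_mx p by rewrite mulmxKV.
rewrite det_mulmx normrM; congr (`|_| * _).
have Cj j l : C j l = bary p l (q (f j)).
  have -> : C j l = (row j C) 0 l by rewrite [RHS]mxE.
  rewrite /C row_mul /bary; congr ((_ *m _) _ _).
  by apply/rowP => c; rewrite [LHS]mxE [LHS]mxE vertex_mxE permE.
have Cji j l : j != i -> C j l = (l == j)%:R by move=> ji; rewrite Cj qf // bary_vertex.
clearbody C.
rewrite (expand_det_col _ i) (bigD1 i) //= [X in _ + X]big1 => [|j ji]; last first.
  by rewrite Cji // eq_sym (negPf ji) mul0r.
rewrite addr0 Cj fi /cofactor addnn -signr_odd odd_double expr0 mul1r.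
rewrite [X in \det X](_ : _ = 1%:M) ?det1 ?mulr1 //.
apply/matrixP => a b; rewrite !mxE Cji ?(inj_eq lift_inj) 1?eq_sym ?neq_lift //.
Qed.

End Simplex.
End Barycentric.

(** * The two sides of a facet, and the existence of a boundary facet *)

Section MeshTopology.
Variables (R : realType) (k : nat) (Omega : set 'rV[R]_k.+1).
Variable M : simplicial_mesh Omega.
Local Notation d := k.+1.
Local Notation elt := 'I_(npred M).+1.
Local Notation lam K i := (bary (@cell_pt _ _ _ M K) i).
Implicit Types (K : elt) (i : 'I_d.+1).

Lemma cell_unit K : vertex_mx (cell_pt K) \in unitmx.
Proof. exact/vertex_mx_unit/cell_nondegenerate. Qed.
Local Hint Resolve cell_unit : core.

Lemma cell_inj K : injective (cell K).
Proof.
move=> i j e; have := bary_vertex (cell_unit K) i j.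
rewrite (_ : cell_pt K j = cell_pt K i); last by rewrite /cell_pt e.
by rewrite bary_vertex // eqxx; case: eqP => // _ /eqP; rewrite oner_eq0.
Qed.

Lemma facet_vertex K i K' i' j : facet K i = facet K' i' -> j != i ->
  exists2 j', j' != i' & cell K' j' = cell K j.
Proof.
move=> e ji; have : cell K j \in facet K i by rewrite imset_f // !inE.
by rewrite e => /imsetP[j']; rewrite !inE => ? ?; exists j'.
Qed.

Lemma facet_vertex_pt K i K' i' j : facet K i = facet K' i' -> j != i ->
  exists2 j', j' != i' & cell_pt K j = cell_pt K' j'.
Proof.
by move=> e /(facet_vertex e)[j' ? h]; exists j' => //; rewrite /cell_pt h.
Qed.

Lemma facet_inj K : injective (facet K).
Proof.
move=> i j e; apply/eqP/negPn/negP => ij.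
have ji : j != i by rewrite eq_sym.
by have [l + /cell_inj lj] := facet_vertex e ji; rewrite lj eqxx.
Qed.

(* Across a shared facet, the barycentric coordinates that vanish on it are
   proportional. *)
Lemma bary_shared_facet K i K' i' x : facet K i = facet K' i' ->
  lam K i x = lam K' i' x * lam K i (cell_pt K' i').
Proof.
move=> e; rewrite {1}(bary_sum (cell_unit K') x).
rewrite bary_comb ?sum_bary // (bigD1 i') //= big1 ?addr0 // => j' ji'.
have [j ji ->] := facet_vertex_pt (esym e) ji'.
by rewrite bary_vertex // eq_sym (negPf ji) mulr0.
Qed.

(** Hence neither factor is zero and both have the same sign: being on the same side is a symmetric
    relation. *)
Lemma bary_opposite K i K' i' : facet K i = facet K' i' ->
  lam K' i' (cell_pt K i) * lam K i (cell_pt K' i') = 1.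
Proof. by move=> e; rewrite -bary_shared_facet // bary_vertex // eqxx. Qed.

Lemma cell_interior K x : (forall i, 0 < lam K i x) -> interior (cell_set K) x.
Proof.
move=> x0; have : (interior [set x | forall i, 0 < lam K i x]) x.
  by have := bary_pos_open (p := cell_pt K); rewrite openE; exact.
apply: interiorS => y /= y0.
(* Weights in [hull] are indexed by mesh vertices, not local ones; by injectivity of [cell K] each
   sum has at most one term. *)
exists (fun v => \sum_(i | cell K i == v) lam K i y).
have s i : \sum_(j | cell K j == cell K i) lam K j y = lam K i y.
  by rewrite (big_pred1 i) // => j; rewrite (inj_eq (@cell_inj K)).
split=> [v||].
- by apply: sumr_ge0 => i _; exact: ltW.
- rewrite big_imset /=; last by move=> i j _ _; exact: cell_inj.
  by under eq_bigr => i _ do rewrite s; exact: sum_bary.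
- rewrite big_imset /=; last by move=> i j _ _; exact: cell_inj.
  by under eq_bigr => i _ do rewrite s; exact: bary_sum.
Qed.

(** Equal weights on the [d] vertices of facet [i], so that [facet_bary] is the barycentre of that
    facet. *)
Definition facet_weight i (j : 'I_d.+1) : R := if j == i then 0 else d%:R^-1.
Definition facet_bary K i := \sum_j facet_weight i j *: cell_pt K j.

Lemma facet_weight_ge0 i j : 0 <= facet_weight i j.
Proof. by rewrite /facet_weight; case: ifP => // _; rewrite invr_ge0 ler0n. Qed.

Lemma sum_facet_weight i : \sum_j facet_weight i j = 1.
Proof.
rewrite (bigD1 i) //= {1}/facet_weight eqxx add0r.
rewrite (eq_bigr (fun=> d%:R^-1)); last by rewrite /facet_weight => j /negPf ->.
rewrite sumr_const cardC1 card_ord -[_ *+ _]mulr_natl mulfV //.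
by rewrite pnatr_eq0.
Qed.

(** At the barycentre of the common facet the coordinates of [K'] other than [i'] are at least 1/d
    and survive a short step, while coordinate [i'] starts at 0 and grows towards a point where it
    is positive. *)
Lemma near_facet_interior K i K' i' : facet K i = facet K' i' ->
  0 < lam K' i' (cell_pt K i) ->
  exists2 e0 : R, 0 < e0 & forall e, 0 < e <= e0 ->
    interior (cell_set K') ((1 - e) *: facet_bary K i + e *: cell_pt K i).
Proof.
move=> eF v0; set v := cell_pt K i.
pose m := \sum_j `|lam K' j v|.
have m0 : 0 <= m by apply: sumr_ge0 => j _.
have lb j : - m <= lam K' j v.
  rewrite lerNl (le_trans (ler_norm _)) // normrN /m (bigD1 j) //= lerDl.
  by apply: sumr_ge0.
have d0 : 0 < d%:R :> R by rewrite ltr0n.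
have e00 : 0 < 2 + d%:R * m.
  by rewrite ltr_pwDl // mulr_ge0 // ltW.
(* Positivity needs (1 - e)/d > e m, where [m] bounds the coordinates of [v]; e (2 + d m) <= 1
   leaves a margin of at least e in 1 - e - e d m. *)
exists (2 + d%:R * m)^-1; first by rewrite invr_gt0.
move=> e /andP[e0 ee]; apply: cell_interior => j'.
have {}ee : e * (2 + d%:R * m) <= 1.
  by rewrite -[leRHS](mulVf (lt0r_neq0 e00)) ler_pM2r.
have e1 : 0 < 1 - e.
  have : 0 <= e * (d%:R * m) by rewrite !mulr_ge0 // ltW.
  by move: ee; lra.
rewrite bary_conv // /facet_bary bary_comb ?sum_facet_weight //.
have [-> | j'i'] := eqVneq j' i'.
  rewrite ltr_wpDl ?mulr_gt0 // mulr_ge0 ?(ltW e1) // sumr_ge0 // => j _.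
  have [->|ji] := eqVneq j i; first by rewrite mulr_ge0 ?facet_weight_ge0 // ltW.
  have [l li' ->] := facet_vertex_pt eF ji.
  by rewrite bary_vertex // eq_sym (negPf li') mulr0.
have [j ji cj] := facet_vertex_pt (esym eF) j'i'.
have wj : facet_weight i j = d%:R^-1 by rewrite /facet_weight (negPf ji).
have key : d%:R^-1 <= \sum_j facet_weight i j * lam K' j' (cell_pt K j).
  rewrite (bigD1 j) //= wj -cj bary_vertex // eqxx mulr1 lerDl.
  apply: sumr_ge0 => l _.
  have [->|li] := eqVneq l i; first by rewrite /facet_weight eqxx mul0r.
  have [l' li' ->] := facet_vertex_pt eF li.
  by rewrite mulr_ge0 ?facet_weight_ge0 // bary_vertex // ler0n.
have h1 := ler_wpM2l (ltW e1) key.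
have h2 := ler_wpM2l (ltW e0) (lb j').
apply: lt_le_trans (lerD h1 h2).
rewrite -(pmulr_rgt0 _ d0) mulrDr mulrCA mulfV ?gt_eqF // mulr1.
have -> : d%:R * (e * - m) = - (e * (d%:R * m)) by ring.
by move: ee; lra.
Qed.

(** Otherwise a point slightly off the barycentre of the facet would be interior to both
    elements. *)
Lemma same_side K i K' i' : facet K i = facet K' i' ->
  0 < lam K i (cell_pt K' i') -> K = K'.
Proof.
move=> eF v0; apply/eqP/negPn/negP => KK'.
have v0' : 0 < lam K' i' (cell_pt K i).
  by rewrite -(pmulr_lgt0 _ v0) bary_opposite.
have v1 : 0 < lam K i (cell_pt K i) by rewrite bary_vertex // eqxx.
have [e1 e10 h1] := near_facet_interior eF v0'.
have [e2 e20 h2] := near_facet_interior (erefl (facet K i)) v1.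
have := mesh_disjoint KK'.
set y := (1 - Num.min e1 e2) *: facet_bary K i + Num.min e1 e2 *: cell_pt K i.
move/seteqP => [/(_ y)] + _; apply; split.
- by apply: h2; rewrite lt_min e10 e20 ge_min lexx orbT.
- by apply: h1; rewrite lt_min e10 e20 ge_min lexx.
Qed.

Lemma opposite_sides K i K' i' : facet K i = facet K' i' -> K != K' ->
  lam K i (cell_pt K' i') < 0.
Proof.
move=> eF KK'; rewrite ltNge le_eqVlt; apply/negP => /orP[/eqP z|/(same_side eF)].
  by have /eqP := bary_opposite eF; rewrite -z mulr0 eq_sym oner_eq0.
exact/eqP.
Qed.

(** [Ka] and [Kb] both lie opposite to [Kc] across the facet, hence on the same side as each
    other. *)
Lemma facet_two_cells (Ka Kb Kc : elt) a b c :
  facet Ka a = facet Kc c -> facet Kb b = facet Kc c -> Ka != Kc -> Kb != Kc ->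
  Ka = Kb.
Proof.
move=> eac ebc ac bc; have eab : facet Ka a = facet Kb b by rewrite eac ebc.
apply: (same_side eab).
have := opposite_sides eac ac; rewrite (bary_shared_facet _ eab).
by rewrite nmulr_rlt0 //; exact: opposite_sides.
Qed.

Lemma det_shared_facet K i K' i' : facet K i = facet K' i' ->
  `|\det (vertex_mx (cell_pt K'))| =
  `|lam K i (cell_pt K' i')| * `|\det (vertex_mx (cell_pt K))|.
Proof.
move=> eF.
(* Matches local indices of the same mesh vertex in [K] and [K'], and the two opposite vertices with
   each other; the default of [odflt] is never taken. *)
pose f j := if j == i then i'
            else odflt i' [pick j' | (j' != i') && (cell K' j' == cell K j)].
have fP j : j != i -> f j != i' /\ cell K' (f j) = cell K j.
  move=> ji; rewrite /f (negPf ji); case: pickP => [j' /andP[? /eqP ?]|] //=.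
  by have [j' n e] := facet_vertex eF ji; move/(_ j'); rewrite n e eqxx.
have fi : f i = i' by rewrite /f eqxx.
apply: (@det_vertex_mx_replace _ _ _ (cell_unit K) _ i i' f) => // [j1 j2|j ji]; last first.
  by rewrite /cell_pt (proj2 (fP j ji)).
have [->|n1] := eqVneq j1 i; have [->|n2] := eqVneq j2 i => // e.
- by have [] := fP _ n2; rewrite -e fi eqxx.
- by have [] := fP _ n1; rewrite e fi eqxx.
- apply: (@cell_inj K); rewrite -(proj2 (fP _ n1)) -(proj2 (fP _ n2)).
  by rewrite e.
Qed.

(* Were every facet shared, the signed contributions |det| * lambda_i(0) of the
   two sides of each facet would cancel, although those of one element add up to
   |det| > 0. *)
Lemma exists_boundary_facet :
  exists K i, hull (@Defs.coord _ _ _ M) (facet K i) `<=` boundary Omega.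
Proof.
apply: contrapT => nb.
have sh (a : elt * 'I_d.+1) :
    exists b : elt * 'I_d.+1, b.1 != a.1 /\ facet a.1 a.2 = facet b.1 b.2.
  have [h|[K' [i' [n e]]]] := mesh_facets a.1 a.2; last by exists (K', i').
  by case: nb; exists a.1, a.2.
have [t tP] := choice sh.
(* [t] is an arbitrary choice of neighbours. Two preimages of one pair would both share its facet,
   which would then lie in three elements unless they coincide. *)
have tI : injective t.
  move=> [K i] [K' i'] e.
  have [/= n1 e1] := tP (K, i); have [/= n2 e2] := tP (K', i').
  rewrite -e in n2 e2.
  have KK : K = K' by apply: (facet_two_cells e1 e2); rewrite eq_sym.
  by move: e1; rewrite -e2 KK => /facet_inj ->.
(* Up to the factor d!, the signed volume of the pyramid over the facet with apex at the origin. *)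
pose F (a : elt * 'I_d.+1) := `|\det (vertex_mx (cell_pt a.1))| * lam a.1 a.2 0.
have Ft a : F (t a) = - F a.
  have [n e] := tP a; rewrite /F (det_shared_facet e) ltr0_norm; last first.
    by apply: opposite_sides e _; rewrite eq_sym.
  rewrite [in RHS](bary_shared_facet _ e); ring.
have : \sum_a F a = - \sum_a F a.
  rewrite {1}(reindex_inj tI) -sumrN; apply: eq_bigr => a _; exact: Ft.
move/eqP; rewrite -addr_eq0 -mulr2n mulrn_eq0 /=.
rewrite /F -(pair_big xpredT xpredT
  (fun K i => `|\det (vertex_mx (cell_pt K))| * lam K i 0)) /=.
under eq_bigr => K _ do rewrite -mulr_sumr sum_bary // mulr1.
rewrite psumr_eq0 // => /allP /(_ ord0); rewrite mem_index_enum normr_eq0.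
by move=> /(_ isT); have := cell_unit ord0; rewrite unitmxE unitfE => /negPf ->.
Qed.

End MeshTopology.

(** * Gradients of barycentric coordinates *)

Section BarycentricGradient.
Variables (R : realType) (k : nat).
Local Notation d := k.+1.
Implicit Types (p : 'I_d.+1 -> 'rV[R]_d).

Definition bary_grad p i : 'rV[R]_d := \row_c invmx (vertex_mx p) (lift ord0 c) i.

Lemma bary_gradE p i x y : dot (bary_grad p i) (x - y) = bary p i x - bary p i y.
Proof.
have e z : bary p i z = invmx (vertex_mx p) ord0 i + dot (bary_grad p i) z.
  rewrite /bary mxE big_ord_recl hom0 mul1r dotE; congr (_ + _).
  by apply: eq_bigr => c _; rewrite homS mulrC mxE.
by rewrite !e -scaleN1r dotDr dotZr; ring.
Qed.

Lemma enorm_eq1 n (u : 'rV[R]_n) : enorm u = 1 -> dot u u = 1.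
Proof. by move=> u1; rewrite -(sqr_sqrtr (dot_ge0 u)) -/(enorm u) u1 expr1n. Qed.

Lemma dot_mulmx m n (u : 'rV[R]_n) (t : 'rV[R]_m) (E : 'M[R]_(m, n)) :
  dot u (t *m E) = \sum_j t 0 j * dot u (row j E).
Proof.
rewrite {1}/dot trmx_mul mulmxA mxE; apply: eq_bigr => j _.
rewrite mulrC (_ : t^T j 0 = t 0 j) 1?mxE // dotE; congr (_ * _).
by apply: eq_bigr => c _; rewrite !mxE.
Qed.

Lemma dot_param m n (q : 'I_m.+1 -> 'rV[R]_n) (u : 'rV[R]_n) (t : 'rV_m) :
  (forall j j', dot u (q j - q j') = 0) -> dot u (t *m edges q) = 0.
Proof. by move=> h; rewrite dot_mulmx big1 // => j _; rewrite rowK h mulr0. Qed.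

End BarycentricGradient.

(** * Normals, measures and the weak gradient on one element *)

Section Element.
Variables (R : realType) (k : nat) (Omega : set 'rV[R]_k.+1).
Variable M : simplicial_mesh Omega.
Local Notation d := k.+1.
Local Notation elt := 'I_(npred M).+1.
Implicit Types (K : elt) (i : 'I_d.+1) (w g : 'rV[R]_d -> 'rV[R]_d).

Lemma cell_edges_unit K : edges (cell_pt K) \in unitmx.
Proof. by rewrite -row_free_unit; exact: cell_nondegenerate. Qed.

Lemma cell_gram_gt0 K : 0 < \det (edges (cell_pt K) *m (edges (cell_pt K))^T).
Proof.
rewrite det_mulmx det_tr -expr2 exprn_even_gt0 //=.
by have := cell_edges_unit K; rewrite unitmxE unitfE.
Qed.

Lemma cell_edges_neq0 K : edges (cell_pt K) != 0.
Proof.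
by apply/eqP => e; have := cell_edges_unit K; rewrite e unitmxE det0 unitr0.
Qed.

Lemma vol_gt0 K : 0 < vol K.
Proof. exact/simplex_measure_gt0/cell_gram_gt0. Qed.

(** The normalized negative gradient of the i-th barycentric coordinate, which is 0 on facet [i] and
    1 at the opposite vertex, is a witness. *)
Lemma normalP K i : is_outward_normal K i (normal K i).
Proof.
apply: (xgetPex 0 (P := is_outward_normal K i)).
set g := bary_grad (cell_pt K) i.
have gE j : dot g (cell_pt K i - facet_pt K i j) = 1.
  rewrite bary_gradE !bary_vertex ?cell_unit // eqxx.
  by rewrite (negPf (neq_lift _ _)) subr0.
have g0 : 0 < dot g g.
  rewrite lt_neqAle dot_ge0 andbT; apply/eqP => /esym/dot_eq0 g0.
  by have /eqP := gE ord0; rewrite g0 dotE big1 ?(eq_sym 0) ?oner_eq0 // => c _; rewrite mxE mul0r.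
exists (- (enorm g)^-1 *: g).
have n0 : 0 < enorm g by rewrite sqrtr_gt0.
split=> [|j j'|j].
- rewrite /enorm dotZl dotZr mulrA mulrNN -expr2 sqrtrM ?sqr_ge0 // sqrtr_sqr.
  by rewrite -/(enorm g) ger0_norm ?mulVf ?gt_eqF // invr_ge0 ltW.
- rewrite dotZl bary_gradE !bary_vertex ?cell_unit //.
  by rewrite !(negPf (neq_lift _ _)) subrr mulr0.
- by rewrite dotZl gE mulr1 oppr_lt0 invr_gt0.
Qed.

(** Pairing with the barycentric gradient of the end point of one edge isolates the coefficient of
    that edge. *)
Lemma facet_edges_free K i (b : 'rV[R]_k) : b *m edges (facet_pt K i) = 0 -> b = 0.
Proof.
move=> b0; apply/rowP => j; rewrite mxE.
have := congr1 (dot (bary_grad (cell_pt K) (lift i (lift ord0 j)))) b0.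
rewrite dot_mulmx [RHS]dotE [RHS]big1 => [|c _]; last by rewrite [X in _ * X]mxE mulr0.
rewrite (bigD1 j) //= big1 ?addr0 => [|j' jj']; rewrite rowK bary_gradE;
  rewrite !bary_vertex ?cell_unit // !(inj_eq lift_inj) [_ == ord0]eq_sym.
- by rewrite eqxx (negPf (neq_lift _ _)) subr0 mulr1.
- by rewrite eq_sym (negPf jj') (negPf (neq_lift _ _)) subrr mulr0.
Qed.

(* The Gram matrix of the facet edges bordered by the unit normal is [X X^T]
   with [X] square, hence it has a positive determinant. *)
Lemma area_gt0 K i : 0 < area K i.
Proof.
apply: simplex_measure_gt0.
have [/enorm_eq1 n1 nE _] := normalP K i.
set n := normal K i in n1 nE *; set E := edges (facet_pt K i).
have En : E *m n^T = 0.
  apply/matrixP => j c; rewrite !ord1 [RHS]mxE.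
  rewrite -[LHS](_ : dot (row j E) n = _); last by rewrite /dot -row_mul mxE.
  by rewrite dotC rowK nE.
pose X : 'M[R]_(1 + k) := col_mx n E.
have XX : X *m X^T = block_mx 1%:M 0 0 (E *m E^T).
  rewrite /X tr_col_mx mul_col_row En -[n *m E^T]trmxK trmx_mul trmxK En trmx0.
  congr block_mx; apply/matrixP => a b; rewrite !ord1 [RHS]mxE eqxx; exact: n1.
have <- : \det (X *m X^T) = \det (E *m E^T) by rewrite XX det_ublock det1 mul1r.
rewrite det_mulmx det_tr -expr2 exprn_even_gt0 //=.
apply/negP => /det0P[v v0]; rewrite -[v]hsubmxK mul_row_col => vX.
move/negP: v0; apply; rewrite -[v]hsubmxK.
have a0 : lsubmx v = 0.
  have := congr1 (mulmx^~ n^T) vX.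
  rewrite /= mulmxDl -!mulmxA En mulmx0 addr0 mul0mx => h.
  by rewrite -h -[LHS]mulmx1; congr (_ *m _); apply/matrixP => a b;
    rewrite !ord1 [LHS]mxE eqxx -[LHS]n1.
move: vX; rewrite a0 mul0mx add0r => /facet_edges_free ->.
by rewrite row_mx0.
Qed.

Definition weak_grad_rhs K (u0 : R) (ub : 'I_d.+1 -> R) w : R :=
  \sum_i facet_int K i (fun x => ub i * dot (w x) (normal K i))
  - cell_int K (fun x => u0 * divergence w x).

Lemma weak_grad_rhsE K u0 ub (a : 'rV[R]_d) (b : R) :
  weak_grad_rhs K u0 ub (fun x => a + b *: x) =
  \sum_i ub i * facet_int K i (fun x => dot (a + b *: x) (normal K i))
  - u0 * (d%:R * b * vol K).
Proof.
congr (_ - _).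
  apply: eq_bigr => i _; rewrite /facet_int.
  by rewrite (simplex_intZ _ _ (g := fun x => a + b *: x) (w := fun=> normal K i)) //;
    [do 2!eexists|exact: RT0_cst].
rewrite /cell_int (@simplex_int_on_cst _ _ _ _ _ (u0 * (d%:R * b))) ?mulrA //.
by move=> t; rewrite divergence_RT0 mulrA.
Qed.

Definition ip K g w : R := cell_int K (fun x => dot (g x) (w x)).

Lemma ipC K g w : ip K g w = ip K w g.
Proof. by rewrite /ip; under eq_fun do rewrite dotC. Qed.

Lemma ip_linl K a g g' w : RT0 g -> RT0 g' -> RT0 w ->
  ip K (fun x => a *: g x + g' x) w = a * ip K g w + ip K g' w.
Proof. exact: simplex_int_dotlin. Qed.

Lemma ip_linr K a g g' w : RT0 g -> RT0 g' -> RT0 w ->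
  ip K w (fun x => a *: g x + g' x) = a * ip K w g + ip K w g'.
Proof. by move=> *; rewrite ipC ip_linl // !(ipC _ w). Qed.

Lemma ip_ge0 K w : RT0 w -> 0 <= ip K w w.
Proof. exact: simplex_int_sqr_ge0. Qed.

Lemma ip_eq0 K w : RT0 w -> ip K w w = 0 -> w = fun=> 0.
Proof. exact: simplex_int_sqr_eq0 (cell_edges_neq0 K) (cell_gram_gt0 K). Qed.

Lemma RT0_rt (th : 'cV[R]_(d + 1)) : RT0 (rt th).
Proof. by apply/rtP; exists th. Qed.
Local Hint Resolve RT0_rt : core.

(** Existence by Riesz: the right-hand side is linear in the test field, and the L^2 product is
    definite on RT_0 coefficients. *)
Lemma weak_gradP K u0 ub : is_weak_grad K u0 ub (weak_grad K u0 ub).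
Proof.
apply: (xgetPex (fun=> 0) (P := is_weak_grad K u0 ub)).
pose b (u v : 'cV[R]_(d + 1)) := ip K (rt u) (rt v).
pose L th := weak_grad_rhs K u0 ub (rt th).
have [|||| th thP] := @riesz _ _ b L.
- by move=> v a u u'; rewrite /b rt_lin ip_linl.
- by move=> v a u u'; rewrite /b rt_lin ip_linr.
(* A field that vanishes identically has zero coefficients: evaluate it at 0 for the constant part,
   then at the vector of ones for the slope. *)
- move=> u u0'; rewrite lt_neqAle ip_ge0 // andbT; apply: contra_neq u0' => /esym.
  move=> /(ip_eq0 (RT0_rt u)) ru0.
  have tu : usubmx u = 0.
    have := congr1 (fun f => f 0) ru0; rewrite /rt scaler0 addr0 => h.
    by rewrite -[LHS]trmxK h trmx0.
  have tb : dsubmx u = 0.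
    have := congr1 (fun f : 'rV[R]_d -> 'rV[R]_d => f (const_mx 1) 0 0) ru0.
    rewrite /rt tu trmx0 add0r !mxE mulr1 => h.
    by apply/matrixP => i j; rewrite !ord1 mxE [RHS]mxE.
  by rewrite -[u]vsubmxK tu tb col_mx0.
- move=> a u v; rewrite /L rt_lin.
  rewrite (_ : (fun x => _) = fun x => (a *: (usubmx u)^T + (usubmx v)^T) +
    (a * dsubmx u 0 0 + dsubmx v 0 0) *: x); last first.
    by apply/funext => x; apply/rowP => c; rewrite !mxE; ring.
  rewrite !weak_grad_rhsE mulrBr mulr_sumr.
  rewrite [RHS](_ : _ = (\sum_i a * (ub i * facet_int K i (fun x => dot (rt u x) (normal K i)))
     + \sum_i ub i * facet_int K i (fun x => dot (rt v x) (normal K i)))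
    - u0 * (d%:R * (a * dsubmx u 0 0 + dsubmx v 0 0) * vol K)); last by rewrite /rt; ring.
  rewrite -big_split /=; congr (_ - _); apply: eq_bigr => i _.
  have := @simplex_int_dotlin _ _ _ (facet_pt K i) a (rt u) (rt v) (fun=> normal K i)
     (RT0_rt u) (RT0_rt v) (RT0_cst _).
  rewrite -!/(facet_int K i _).
  rewrite (_ : (fun x => dot (a *: rt u x + rt v x) _) = fun x =>
    dot (a *: (usubmx u)^T + (usubmx v)^T + (a * dsubmx u 0 0 + dsubmx v 0 0) *: x)
      (normal K i)); last first.
    apply/funext => x; congr (dot _ _); apply/rowP => c; rewrite !mxE; ring.
  by move=> ->; ring.
exists (rt th); split=> // w /rtP[eta ->]; exact: thP.
Qed.

Lemma weak_grad_RT0 K u0 ub : RT0 (weak_grad K u0 ub).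
Proof. by have [] := weak_gradP K u0 ub. Qed.

Lemma ip_weak_grad K u0 ub w : RT0 w ->
  ip K (weak_grad K u0 ub) w = weak_grad_rhs K u0 ub w.
Proof. by have [_] := weak_gradP K u0 ub; exact. Qed.

(** Linearity is a matter of uniqueness: both sides have the same products with all of RT_0, so
    their difference is orthogonal to itself. *)
Lemma weak_grad_lin K a u0 ub v0 vb :
  weak_grad K (a * u0 + v0) (fun i => a * ub i + vb i) =
  fun x => a *: weak_grad K u0 ub x + weak_grad K v0 vb x.
Proof.
set g := weak_grad K (a * u0 + v0) _; set h := fun x => _.
have hR : RT0 h by apply: RT0_lin; exact: weak_grad_RT0.
have gR : RT0 g by exact: weak_grad_RT0.
have e w : RT0 w -> ip K g w = ip K h w.
  move=> wR; rewrite /g /h ip_linl ?ip_weak_grad //; try exact: weak_grad_RT0.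
  move: wR => [A [B ->]]; rewrite !weak_grad_rhsE mulrBr mulr_sumr.
  under eq_bigr => i _ do rewrite mulrDl -mulrA.
  rewrite big_split /=; ring.
have dR : RT0 (fun x => (-1) *: h x + g x) by exact: RT0_lin.
have z : ip K (fun x => (-1) *: h x + g x) (fun x => (-1) *: h x + g x) = 0.
  by rewrite ip_linl // e // mulN1r addNr.
apply/funext => x; have := congr1 (fun f => f x) (ip_eq0 dR z).
by rewrite /= scaleN1r addrC => /eqP; rewrite subr_eq0 => /eqP.
Qed.

(** A constant test field has no divergence, so only facet fluxes remain. This is the link between
    the weak gradient and the pressure form. *)
Lemma ip_weak_grad_cst K u0 ub (a : 'rV[R]_d) :
  ip K (weak_grad K u0 ub) (fun=> a) = \sum_i area K i * (ub i * dot a (normal K i)).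
Proof.
rewrite ip_weak_grad; last exact: RT0_cst.
rewrite (_ : (fun=> a) = fun x => a + 0 *: x); last first.
  by apply/funext => x; rewrite scale0r addr0.
rewrite weak_grad_rhsE mulr0 mul0r mulr0 subr0; apply: eq_bigr => i _.
rewrite /facet_int (@simplex_int_on_cst _ _ _ _ _ (dot a (normal K i))).
  by rewrite -/(area K i); ring.
by move=> t; rewrite scale0r addr0.
Qed.

(* Tested against [x - p_j], which is tangential on the facets through [p_j]. *)
Lemma weak_grad_eq0 K u0 ub : weak_grad K u0 ub = (fun=> 0) ->
  forall j, exists2 h, 0 < h & ub j * h = u0 * (d%:R * vol K).
Proof.
move=> g0 j.
have wR : RT0 (fun x => - cell_pt K j + 1 *: x) by do 2!eexists.
have := ip_weak_grad K u0 ub wR; rewrite g0 weak_grad_rhsE.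
have -> : ip K (fun=> 0) (fun x => - cell_pt K j + 1 *: x) = 0.
  rewrite /ip /cell_int (@simplex_int_on_cst _ _ _ _ _ 0) ?mul0r // => t.
  by rewrite dotE big1 // => c _; rewrite mxE mul0r.
move=> /esym/eqP; rewrite subr_eq0 mulr1 => /eqP <-.
have val i t : dot (- cell_pt K j + 1 *: simplex_param (facet_pt K i) t) (normal K i) =
    dot (normal K i) (facet_pt K i ord0 - cell_pt K j).
  have [_ nE _] := normalP K i.
  rewrite scale1r /simplex_param dotC addrCA addrA [LHS]dotDr.
  by rewrite dot_param // addr0.
rewrite (bigD1 j) //= big1 ?addr0 => [|i ij].
  (* The flux of x - p_j through the facet opposite to p_j, positive because the normal points away
     from p_j. *)
  exists (facet_int K j (fun x => dot (- cell_pt K j + 1 *: x) (normal K j))) => //.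
  rewrite /facet_int (simplex_int_on_cst (val j)) mulr_gt0 ?area_gt0 //.
  have [_ _ /(_ ord0)] := normalP K j.
  by rewrite -opprB dotC dotNl oppr_lt0 dotC.
rewrite /facet_int (simplex_int_on_cst (val i)).
have [_ nE _] := normalP K i.
case: (unliftP i j) ij => [l -> _|->]; last by rewrite eqxx.
by rewrite nE mul0r mulr0.
Qed.

End Element.

(** * The stiffness and pressure forms on the whole mesh *)

Section Global.
Variables (R : realType) (k : nat) (Omega : set 'rV[R]_k.+1).
Variable M : simplicial_mesh Omega.
Local Notation d := k.+1.
Local Notation elt := 'I_(npred M).+1.
Local Notation N := (npred M).+1.
Implicit Types (K : elt) (i : 'I_d.+1) (u v : 'cV[R]_(ndof M)) (q : 'cV[R]_N).

Lemma cell_val_lin a u v K c :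
  cell_val (a *: u + v) K 0 c = a * cell_val u K 0 c + cell_val v K 0 c.
Proof. by rewrite !mxE. Qed.

Lemma facet_val_lin a u v e c :
  facet_val (a *: u + v) e 0 c = a * facet_val u e 0 c + facet_val v e 0 c.
Proof. by rewrite !mxE; case: insub => [e'|]; rewrite ?mxE // mulr0 addr0. Qed.

Lemma facet_val_boundary u e : ~~ interior_facet e -> facet_val u e = 0.
Proof. by move=> b; apply/rowP => c; rewrite !mxE insubN. Qed.

Definition row_grad u K (c : 'I_d) : 'rV[R]_d -> 'rV[R]_d :=
  weak_grad K (cell_val u K 0 c) (fun i => facet_val u (facet K i) 0 c).

Lemma row_grad_RT0 u K c : RT0 (row_grad u K c).
Proof. exact: weak_grad_RT0. Qed.
Local Hint Resolve row_grad_RT0 : core.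

Lemma row_grad_lin a u v K c :
  row_grad (a *: u + v) K c = fun x => a *: row_grad u K c x + row_grad v K c x.
Proof.
rewrite /row_grad -weak_grad_lin cell_val_lin; congr (weak_grad _ _ _).
by apply/funext => i; rewrite facet_val_lin.
Qed.

Lemma stiffness_formE u v :
  stiffness_form u v = \sum_K \sum_c ip K (row_grad u K c) (row_grad v K c).
Proof.
apply: eq_bigr => K _; rewrite /ip /cell_int -simplex_int_dot_sum //.
congr (simplex_int _ _); apply/funext => x; rewrite /mxtrace.
apply: eq_bigr => c _; rewrite mxE dotE; apply: eq_bigr => j _.
by rewrite [X in _ * X = _]mxE [X in _ * X = _]mxE [X in X * _ = _]mxE.
Qed.

Lemma stiffness_formC u v : stiffness_form u v = stiffness_form v u.
Proof.
by rewrite !stiffness_formE; do 2!(apply: eq_bigr => ? _); rewrite ipC.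
Qed.

Lemma stiffness_form_lin a u u' v :
  stiffness_form (a *: u + u') v = a * stiffness_form u v + stiffness_form u' v.
Proof.
rewrite !stiffness_formE mulr_sumr -big_split; apply: eq_bigr => K _ /=.
rewrite mulr_sumr -big_split; apply: eq_bigr => c _ /=.
by rewrite row_grad_lin ip_linl.
Qed.

Lemma stiffness_mxP u v : (v^T *m stiffness_mx M *m u) 0 0 = stiffness_form u v.
Proof.
apply: (xgetPex 0 (P := [set A | forall u v, (v^T *m A *m u) 0 0 = stiffness_form u v])).
apply: bilinear_mx => [w a x y|w a x y]; first exact: stiffness_form_lin.
by rewrite stiffness_formC stiffness_form_lin !(stiffness_formC w).
Qed.

Lemma pressure_mxP q u : (q^T *m pressure_mx M *m u) 0 0 = pressure_form q u.
Proof.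
apply: (xgetPex 0 (P := [set B | forall q u, (q^T *m B *m u) 0 0 = pressure_form q u])).
have [|| B BP] := @bilinear_mx R _ _ (fun u q => @pressure_form R k Omega M q u).
- move=> p a x y; rewrite /pressure_form mulr_sumr -big_split; apply: eq_bigr => K _ /=.
  rewrite mulr_sumr -big_split; apply: eq_bigr => i _ /=.
  rewrite (_ : facet_val (a *: x + y) _ = a *: facet_val x (facet K i) + facet_val y (facet K i)).
    by rewrite dotDl dotZl; ring.
  by apply/rowP => c; rewrite facet_val_lin [RHS]mxE; congr (_ + _); rewrite [RHS]mxE.
- move=> w a x y; rewrite /pressure_form mulr_sumr -big_split; apply: eq_bigr => K _ /=.
  rewrite mulr_sumr -big_split; apply: eq_bigr => i _ /=.
  by rewrite !mxE; ring.
by exists B => p w; rewrite BP.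
Qed.

Lemma stiffness_mx_sym : (stiffness_mx M)^T = stiffness_mx M.
Proof.
apply/matrixP => i j.
have e (X : 'M[R]_(ndof M)) a b : X a b = ((delta_mx a 0 : 'cV_ _)^T *m X *m (delta_mx b 0 : 'cV_ _)) 0 0.
  by rewrite trmx_delta -rowE -colE !mxE.
by rewrite mxE !e !stiffness_mxP stiffness_formC.
Qed.

Hypothesis M_connected : connected_mesh M.

Lemma connected_mesh_ind (P : elt -> Prop) K0 :
  P K0 -> (forall K K', Defs.adjacent K K' -> P K -> P K') -> forall K, P K.
Proof.
move=> P0 PS K; have /connectP[s sp ->] := M_connected K0 K.
elim: s K0 P0 sp => //= K1 s IH K0 P0 /andP[a01 sp].
by apply: IH sp; exact: PS a01 P0.
Qed.

Lemma stiffness_form_ge0 u : 0 <= stiffness_form u u.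
Proof.
by rewrite stiffness_formE; do 2!(apply: sumr_ge0 => ? _); exact: ip_ge0.
Qed.

Lemma stiffness_form_eq0 u : stiffness_form u u = 0 -> u = 0.
Proof.
rewrite stiffness_formE => s0.
have g0 K c : row_grad u K c = fun=> 0.
  apply: (ip_eq0 (K := K)) => //; apply/eqP.
  move/eqP: s0; rewrite psumr_eq0 => [/allP/(_ K)|K' _]; last first.
    by apply: sumr_ge0 => ? _; exact: ip_ge0.
  rewrite mem_index_enum psumr_eq0 => [/(_ isT)/allP/(_ c)|? _]; last exact: ip_ge0.
  by rewrite mem_index_enum => /(_ isT).
pose Z c K := cell_val u K 0 c = 0 /\ forall i, facet_val u (facet K i) 0 c = 0.
have ZF c K i : facet_val u (facet K i) 0 c = 0 -> Z c K.
  have wg := weak_grad_eq0 (g0 K c).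
  have dv : d%:R * vol K != 0 :> R by rewrite mulf_neq0 ?pnatr_eq0 // gt_eqF ?vol_gt0.
  move=> f0; have [h _ /esym/eqP] := wg i.
  rewrite f0 mul0r mulf_eq0 (negPf dv) orbF => /eqP c0; split=> // j.
  have [h' h'0 /eqP] := wg j.
  by rewrite c0 mul0r mulf_eq0 (gt_eqF h'0) orbF => /eqP.
have Zall c K : Z c K.
  have [K0 [i0 bd]] := exists_boundary_facet M.
  apply: (@connected_mesh_ind (Z c) K0) K.
    apply: (ZF c K0 i0); rewrite facet_val_boundary; first by rewrite mxE.
    by rewrite /interior_facet negb_and; apply/orP; right; rewrite negbK; apply/asboolP.
  move=> K K' /andP[_ /existsP[i /existsP[i' /andP[/eqP e _]]]] [_ zK].
  by apply: (ZF c K' i'); rewrite -e.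
apply/colP => j; rewrite mxE -[j]enum_valK.
case: (enum_val j) => [[K|e] c].
  by have [+ _] := Zall c K; rewrite mxE.
have /andP[/existsP[K /existsP[i /eqP eK]] _] := valP e.
by have [_ /(_ i)] := Zall c K; rewrite -eK mxE valK.
Qed.

Lemma stiffness_posdef : posdef_mx (stiffness_mx M).
Proof.
move=> u u0; rewrite stiffness_mxP lt_neqAle stiffness_form_ge0 andbT.
by apply: contra_neq u0 => /esym/stiffness_form_eq0.
Qed.

(** Adds up the row inequalities on one element; each row contributes one copy of [V * x ^+ 2],
    which makes the factor [n%:R]. *)
Lemma sum_complete_square n (V x : R) (a b : 'I_n -> R) :
  (forall c, 0 <= x ^+ 2 * V - x *+ 2 * a c + b c) ->
  (x * \sum_c a c) *+ 2 <= n%:R * (V * x ^+ 2) + \sum_c b c.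
Proof.
move=> h; have : 0 <= \sum_c (x ^+ 2 * V - x *+ 2 * a c + b c) by exact: sumr_ge0.
rewrite !big_split /= sumrN -!mulr_sumr sumr_const card_ord => s0.
rewrite -subr_ge0; apply: le_trans s0 _.
by rewrite -[_ *+ n]mulr_natl le_eqVlt; apply/orP; left; apply/eqP; ring.
Qed.

Lemma pressure_form_bound q u :
  pressure_form q u *+ 2 <= d%:R * (\sum_K vol K * q K 0 ^+ 2) + stiffness_form u u.
Proof.
rewrite stiffness_formE mulr_sumr -sumrMnl -big_split; apply: ler_sum => K _ /=.
(* Testing row [c] with the unit vector e_c gives the integral of the trace. Boundary facets may be
   added to the sum because velocities vanish there. *)
have -> : \sum_(i | interior_facet (facet K i))
    area K i * q K 0 * dot (facet_val u (facet K i)) (normal K i) =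
    q K 0 * \sum_c ip K (row_grad u K c) (fun=> delta_mx 0 c).
  under [in RHS]eq_bigr => c _ do rewrite ip_weak_grad_cst.
  rewrite exchange_big /= mulr_sumr [RHS](bigID (fun i => interior_facet (facet K i))) /=.
  rewrite [X in _ + X]big1 ?addr0 => [|i b]; last first.
    by rewrite big1 ?mulr0 // => c _; rewrite facet_val_boundary // mxE mul0r mulr0.
  apply: eq_bigr => i _; rewrite dotE -mulr_sumr mulrA (mulrC (q K 0)); congr (_ * _).
  apply: eq_bigr => c _; congr (_ * _); rewrite dotE (bigD1 c) //= big1 ?addr0.
    by rewrite mxE !eqxx mul1r.
  by move=> c' cc'; rewrite mxE eqxx (negPf cc') mul0r.
have dd c : ip K (fun=> delta_mx 0 c) (fun=> delta_mx 0 c) = vol K.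
  rewrite /ip /cell_int (@simplex_int_on_cst _ _ _ _ _ 1) ?mul1r // => _.
  rewrite dotE (bigD1 c) //= big1 ?addr0 => [|c' cc'].
    by rewrite mxE !eqxx mulr1.
  by rewrite mxE eqxx (negPf cc') mul0r.
(* The squared L^2 norm of row [c] of grad_w u - q_K I. *)
have sq c : 0 <= q K 0 ^+ 2 * vol K
    - q K 0 *+ 2 * ip K (row_grad u K c) (fun=> delta_mx 0 c)
    + ip K (row_grad u K c) (row_grad u K c).
  pose e : 'rV[R]_d -> 'rV[R]_d := fun=> delta_mx 0 c.
  have eR : RT0 e by exact: RT0_cst.
  have hR := RT0_lin (- q K 0) eR (row_grad_RT0 u K c).
  apply: le_trans (ip_ge0 K hR) _; rewrite ip_linl // !ip_linr // (ipC K e) dd.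
  by rewrite le_eqVlt; apply/orP; left; apply/eqP; ring.
exact: sum_complete_square.
Qed.

Lemma pressure_form_eq0 q : q ord0 0 = 0 -> (forall u, pressure_form q u = 0) -> q = 0.
Proof.
move=> q0 pq; apply/colP => K; rewrite mxE.
apply: (@connected_mesh_ind (fun K => q K 0 = 0) ord0) K => // K K'.
move=> /andP[KK' /existsP[i /existsP[i' /andP[/eqP e eI]]]] qK.
pose n := normal K' i'.
(* A velocity supported on the facet shared by [K] and [K'], equal there to the unit normal of [K'].
   As q_K = 0, the pressure form reduces to |e| q_{K'}. *)
pose v : 'cV[R]_(ndof M) := \col_j
  match (enum_val j).1 with
  | inl _ => 0
  | inr e' => if val e' == facet K i then n 0 (enum_val j).2 else 0
  end.
have ve : facet_val v (facet K i) = n.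
  by apply/rowP => c; rewrite mxE insubT mxE enum_rankK /= eqxx.
have vN e' : e' != facet K i -> facet_val v e' = 0.
  move=> ne; apply/rowP => c; rewrite !mxE; case: insubP => // s _ es.
  by rewrite mxE enum_rankK /= es (negPf ne).
have [/enorm_eq1 n1 _ _] := normalP K' i'.
have := pq v; rewrite /pressure_form (bigD1 K') //= [X in _ + X]big1 ?addr0 => [|K2 K2K'].
  rewrite (bigD1 i') -?e //= ve n1 mulr1 big1 ?addr0 => [|i2 /andP[_ i2i']].
    by move/eqP; rewrite mulf_eq0 gt_eqF ?area_gt0 //= => /eqP.
  by rewrite vN ?dotE ?big1 ?mulr0 // => [c _|]; [rewrite mxE mul0r|rewrite e (inj_eq (@facet_inj _ _ _ _ K'))].
apply: big1 => i2 _.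
have [->|K2K] := eqVneq K2 K; first by rewrite qK mulr0 mul0r.
rewrite vN ?dotE ?big1 ?mulr0 // => [c _|]; first by rewrite mxE mul0r.
(* An element other than [K] that contains the support of [v] must be [K']. *)
apply/eqP => e2; move/eqP: K2K'; apply.
by apply: (facet_two_cells e2 (esym e)); rewrite // eq_sym.
Qed.

End Global.

(** * The Schur complement *)

Section Schur.
Variable R : realType.

Lemma symmetric_congr m n (A : 'M[R]_n) (B : 'M[R]_(m, n)) :
  A^T = A -> (B *m invmx A *m B^T)^T = B *m invmx A *m B^T.
Proof. by move=> sA; rewrite !trmx_mul trmxK trmx_inv sA mulmxA. Qed.

Lemma qform_diag n (r : 'rV[R]_n) (x : 'cV[R]_n) :
  (x^T *m diag_mx r *m x) 0 0 = \sum_i r 0 i * x i 0 ^+ 2.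
Proof. by rewrite mul_mx_diag mxE; apply: eq_bigr => i _; rewrite !mxE; ring. Qed.

Lemma regularization_diag (k : nat) (Omega : set 'rV[R]_k.+1)
    (M : simplicial_mesh Omega) d11 :
  regularization M d11 = diag_mx (\row_i (d11 *+ (i == ord0))).
Proof.
apply/matrixP => i j; rewrite !mxE.
have [->|ij] := eqVneq i j; first by rewrite andbb mulr1n mulr_natr.
rewrite mulr0n; case: (eqVneq i ord0) => [i0|_]; last by rewrite mulr0.
by case: (eqVneq j ord0) => [j0|_]; rewrite ?mulr0 //; rewrite i0 j0 eqxx in ij.
Qed.

Lemma qform_regularization (k : nat) (Omega : set 'rV[R]_k.+1)
    (M : simplicial_mesh Omega) mu d11 (x : 'cV[R]_((npred M).+1)) :
  (x^T *m (mu *: regularization M d11) *m x) 0 0 = mu * d11 * x ord0 0 ^+ 2.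
Proof.
rewrite regularization_diag -scalemxAr -scalemxAl mxE qform_diag -mulrA.
congr (_ * _); rewrite (bigD1 ord0) //= big1 ?addr0 => [|i /negPf i0].
  by rewrite mxE eqxx.
by rewrite mxE i0 mul0r.
Qed.

End Schur.

Theorem lemma2p3 (R : realType) (k : nat) (hd : k.+1 = 2%N \/ k.+1 = 3%N)
    (Omega : set 'rV[R]_k.+1)
    (Omega_open : open Omega) (Omega_connected : connected Omega)
    (Omega_nonempty : Omega !=set0) (Omega_bounded : bounded_set Omega)
    (M : simplicial_mesh Omega) (M_connected : connected_mesh M)
    (sigma : R) (M_quasi_uniform : quasi_uniform M sigma)
    (mu d11 : R) (mu_gt0 : 0 < mu) (d11_gt0 : 0 < d11) :
  let A := stiffness_mx M in
  let B := pressure_mx M in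
  let D := regularization M d11 in
  let S := mu *: D + B *m invmx A *m B^T in
  [/\ S = - schur (saddle_mx M mu d11),
      symmetric_mx S,
      posdef_mx S,
      loewner_le (mu *: D) S
    & loewner_le S
        ((k.+1%:R + mu * (d11 / vol (M := M) ord0)) *: pressure_mass M)].
Proof.
move=> A B D S.
have A_unit : A \in unitmx := posdef_mx_unit (stiffness_posdef M_connected).
pose T := B *m invmx A *m B^T.
have T_sym : T^T = T := symmetric_congr _ (stiffness_mx_sym M).
have D_sym : (mu *: D)^T = mu *: D by rewrite /D regularization_diag linearZ /= tr_diag_mx.
have S_sym : S^T = S by rewrite linearD /= D_sym T_sym.
(* The discrete velocity driven by the pressure [q]; its energy equals q^T T q. *)
pose y (q : 'cV[R]_((npred M).+1)) := invmx A *m B^T *m q.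
have yP q v : stiffness_form (y q) v = pressure_form q v.
  rewrite -stiffness_mxP -pressure_mxP -/A -/B /y !mulmxA mulmxK //.
  rewrite (_ : v^T *m B^T *m q = (q^T *m B *m v)^T) ?mxE //.
  by rewrite !trmx_mul trmxK mulmxA.
have TE q : (q^T *m T *m q) 0 0 = pressure_form q (y q).
  by rewrite -pressure_mxP -/B /y /T !mulmxA.
have T_ge0 (q : 'cV_ _) : 0 <= (q^T *m T *m q) 0 0 by rewrite TE -yP stiffness_form_ge0.
have SE (q : 'cV_ _) : (q^T *m S *m q) 0 0 = mu * d11 * q ord0 0 ^+ 2 + (q^T *m T *m q) 0 0.
  by rewrite mulmxDr mulmxDl mxE qform_regularization.
have mud : 0 < mu * d11 by rewrite mulr_gt0.
split=> //.
(* The two minus signs of the off-diagonal blocks cancel in the product. *)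
- rewrite /schur /saddle_mx block_mxKul block_mxKur block_mxKdl block_mxKdr.
  by rewrite mulNmx mulmxN mulNmx opprK opprD !opprK.
- move=> q q0; rewrite SE.
  have q0_ge0 : 0 <= mu * d11 * q ord0 0 ^+ 2 by rewrite mulr_ge0 ?sqr_ge0 ?ltW.
  rewrite lt_neqAle addr_ge0 // andbT.
  apply: contra_neq q0 => /esym/eqP; rewrite paddr_eq0 // => /andP[].
  rewrite mulf_eq0 (gt_eqF mud) sqrf_eq0 => /eqP q0 /eqP.
  rewrite TE -yP => /(stiffness_form_eq0 M_connected) y0.
  apply: (pressure_form_eq0 M_connected q0) => v.
  by rewrite -yP y0 -stiffness_mxP mulmx0 mxE.
- rewrite /loewner_le (_ : S - mu *: D = T); last by rewrite /S addrC addKr.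
  by split.
- split.
    by rewrite /symmetric_mx linearB /= S_sym linearZ /= tr_diag_mx.
  move=> q; rewrite mulmxBr mulmxBl [X in 0 <= X]mxE [X in _ + X]mxE SE.
  rewrite -scalemxAr -scalemxAl [X in X - _]mxE qform_diag.
  under eq_bigr => K _ do rewrite mxE.
  set m := \sum_K _.
  (* For u = y q the bound reads 2 q^T T q <= d m + q^T T q, and one copy cancels. *)
  have t_le : (q^T *m T *m q) 0 0 <= k.+1%:R * m.
    have := pressure_form_bound q (y q).
    by rewrite yP -TE mulr2n -/m lerD2r.
  have m_ge : vol (M := M) ord0 * q ord0 0 ^+ 2 <= m.
    rewrite /m (bigD1 ord0) //= lerDl sumr_ge0 // => K _.
    by rewrite mulr_ge0 ?sqr_ge0 // ltW // vol_gt0.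
  have v0 := vol_gt0 (M := M) ord0.
  (* |K_1| q_1^2 is a single term of the nonnegative sum [m]; this is where the division by |K_1|
     comes from. *)
  have d_le : mu * d11 * q ord0 0 ^+ 2 <= mu * (d11 / vol (M := M) ord0) * m.
    have -> : mu * (d11 / vol (M := M) ord0) * m = mu * d11 * (m / vol (M := M) ord0).
      by ring.
    by rewrite ler_pM2l // ler_pdivlMr // mulrC.
  by rewrite mulrDl subr_ge0 addrC lerD.
Qed.
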